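(* Let $R$ be a non-primitive Dedekind prime ring and let $M$ be a right $R$-module. The following are equivalent: (1) $M$ is hereditarily Bassian. (2) Each primary component of $\mathrm{Sing}(M)$ is Noetherian and there exists a finitely generated non-singular submodule $G$ of $M$ such that $M/G$ is singular. (3) Each primary component of $\mathrm{Sing}(M)$ is finitely generated and there exists a finitely generated submodule $G$ of $M$ such that $M/G$ is singular.
   Context: Rings are associative with identity and modules are unital right modules. A module $M$ is Bassian if, for every submodule $N$ of $M$, the existence of a monomorphism $M\to M/N$ forces $N=0$. A module $M$ is hereditarily Bassian if every submodule of $M$ is Bassian. $\mathrm{Sing}(M)$ denotes the singular submodule of $M$, i.e. the set of $m\in M$ whose right annihilator in $R$ is an essential right ideal; $M$ is singular if $\mathrm{Sing}(M)=M$ and non-singular if $\mathrm{Sing}(M)=0$. An HNP ring is a hereditary Noetherian prime ring (on both sides). A ring is non-primitive if it has no faithful simple right module and no faithful simple left module. A Dedekind prime ring is an HNP ring, with classical ring of fractions $Q$, in which every non-zero two-sided ideal is invertible in $Q$ (an ideal $I$ is invertible if $IJ=JI=R$ for some $R$-sub-bimodule $J$ of $Q$). A maximal invertible ideal is an ideal maximal among the proper invertible ideals of $R$. For a maximal invertible ideal $P$, the $P$-primary component of a module $X$ is $X(P)=\{x\in X : xP^n=0 \text{ for some } n\ge 1\}$; the primary components of $X$ are the submodules $X(P)$ with $P$ ranging over all maximal invertible ideals of $R$. *)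

(* Defs.v *)
From HB Require Import structures.
From mathcomp Require Import all_boot all_order all_algebra.
From mathcomp Require Import boolp classical_sets.

Set Implicit Arguments.
Unset Strict Implicit.
Unset Printing Implicit Defensive.

Import GRing.Theory.
Local Open Scope ring_scope.
Local Open Scope quotient_scope.
Local Open Scope classical_set_scope.

(* A right module over R is an object of [lmodType R^c], with R^c the converse
   ring: for v in such a module and r in R, the product v r is written
   [(r : R^c) *: v].  Accordingly, the right ideals of R are the submodules of
   (R^c)^o, its left ideals are those of R^o, and each notion defined below for
   left modules over an arbitrary ring A yields the right-handed notion over R
   when A := R^c. *)

Section Modules.
Context {A : nzRingType} {V : lmodType A}.
Implicit Types N : submodClosed V.

Record submod N := Submod {
  submod_val : V;
  submod_valP : submod_val \in N
}.

HB.instance Definition _ N := [isSub for @submod_val N].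
HB.instance Definition _ N := [Choice of submod N by <:].
HB.instance Definition _ N := [SubChoice_isSubLmodule of submod N by <:].

Lemma submod_zmod_closed N : zmod_closed N.
Proof. exact: (submodClosedP N : zmod_closed _). Qed.

Definition submod_zmod N : zmodClosed V :=
  HB.pack (N : {pred V}) (GRing.isZmodClosed.Build V (N : {pred V}) (submod_zmod_closed N)).

(* The quotient module V / N. *)
Definition quotmod N : Type := Quotient.quot (submod_zmod N).

HB.instance Definition _ N := Choice.on (quotmod N).
HB.instance Definition _ N := ZmodQuotient.on (quotmod N).

Definition quotmod_scale N (a : A) (x : quotmod N) : quotmod N :=
  \pi_(quotmod N) (a *: repr x).

Lemma quotmod_scale_pi N (a : A) (v : V) :
  quotmod_scale a (\pi_(quotmod N) v) = \pi_(quotmod N) (a *: v).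
Proof.
apply/eqP; rewrite /quotmod_scale -Quotient.idealrBE -scalerBr.
apply: (@rpredZ _ _ N).
by rewrite -[_ \in _]/(_ \in submod_zmod N) Quotient.idealrBE reprK.
Qed.

Fact quotmod_scaleA N (a b : A) (x : quotmod N) :
  quotmod_scale a (quotmod_scale b x) = quotmod_scale (a * b) x.
Proof.
by rewrite -[x]reprK (quotmod_scale_pi _ b) !quotmod_scale_pi scalerA.
Qed.

Fact quotmod_scale1 N : left_id 1 (@quotmod_scale N).
Proof. by move=> x; rewrite -[x]reprK quotmod_scale_pi scale1r. Qed.

Fact quotmod_piD N :
  {morph \pi_(quotmod N) : u v / u + v >-> u + v}.
Proof. exact: Quotient.pi_add. Qed.

Fact quotmod_scaleDr N : right_distributive (@quotmod_scale N) +%R.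
Proof.
move=> a x y; rewrite -[x]reprK -[y]reprK -quotmod_piD.
by rewrite !(quotmod_scale_pi _ a) scalerDr quotmod_piD.
Qed.

Fact quotmod_scaleDl N (x : quotmod N) :
  {morph (@quotmod_scale N)^~ x : a b / a + b}.
Proof.
by move=> a b; rewrite -[x]reprK !quotmod_scale_pi scalerDl quotmod_piD.
Qed.

HB.instance Definition _ N := GRing.Zmodule_isLmodule.Build A (quotmod N)
  (@quotmod_scaleA N) (@quotmod_scale1 N)
  (@quotmod_scaleDr N) (@quotmod_scaleDl N).

Fact quotmod_pi_scalable N : scalable (\pi_(quotmod N)).
Proof. by move=> a v; rewrite -quotmod_scale_pi. Qed.

HB.instance Definition _ N :=
  GRing.isScalable.Build A V (quotmod N) *:%R \pi_(quotmod N)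
    (@quotmod_pi_scalable N).

End Modules.

Section ModuleNotions.
Context {A : nzRingType}.

Definition finitely_generated (V : lmodType A) : Prop :=
  exists (n : nat) (g : 'I_n -> V),
    forall v : V, exists c : 'I_n -> A, v = \sum_(i < n) c i *: g i.

Definition noetherian (V : lmodType A) : Prop :=
  forall N : nat -> submodClosed V,
    (forall i, {subset N i <= N i.+1}) ->
    exists n, forall m, (n <= m)%N -> N m =i N n.

Definition projective (P : lmodType A) : Prop :=
  forall (X Y : lmodType A) (g : {linear X -> Y}) (f : {linear P -> Y}),
    (forall y, exists x, g x = y) ->
    exists h : {linear P -> X}, forall p, g (h p) = f p.

Definition simple_module (V : lmodType A) : Prop :=
  (exists v : V, v != 0) /\
  forall N : submodClosed V,
    (forall v, v \in N -> v = 0) \/ (forall v, v \in N).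

Definition faithful_module (V : lmodType A) : Prop :=
  forall a : A, (forall v : V, a *: v = 0) -> a = 0.

Definition essential (V : lmodType A) (E : {pred V}) : Prop :=
  forall N : submodClosed V,
    (forall v, v \in N -> v \in E -> v = 0) -> forall v, v \in N -> v = 0.

Definition ann (V : lmodType A) (v : V) : {pred A^o} :=
  [pred a : A^o | (a : A) *: v == 0].

Definition Sing_pred (V : lmodType A) : {pred V} :=
  [pred v | `[< essential (ann v) >]].

Lemma Sing_submod_closed (V : lmodType A) : submod_closed (@Sing_pred V).
Proof.
split=> [|a u v].
  by apply/asboolP => N N0 b Nb; apply: N0 => //; rewrite inE scaler0.
move=> /asboolP essu /asboolP essv; apply/asboolP => N N0.
pose Kv : {pred A^o} := [pred b : A^o | (b \in N) && (b \in ann v)].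
have Kv_closed : submod_closed Kv.
  split=> [|c x y]; first by rewrite !inE rpred0 scale0r eqxx.
  rewrite !inE => /andP[Nx /eqP xv] /andP[Ny /eqP yv].
  by rewrite rpredD ?rpredZ //= scalerDl -scalerA xv yv scaler0 addr0 eqxx.
pose Nv : submodClosed A^o :=
  HB.pack Kv (GRing.isSubmodClosed.Build A A^o Kv Kv_closed).
pose Kva : {pred A^o} :=
  [pred b : A^o | `[< exists2 c : A^o, c \in Nv & b = (c : A) * a >]].
have Kva_closed : submod_closed Kva.
  split=> [|c x y]; first by apply/asboolP; exists 0; rewrite ?rpred0 ?mul0r.
  move=> /asboolP[x' Nx' ->] /asboolP[y' Ny' ->]; apply/asboolP.
  by exists (c *: x' + y'); [rewrite rpredD ?rpredZ | rewrite mulrDl -mulrA].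
pose Nva : submodClosed A^o :=
  HB.pack Kva (GRing.isSubmodClosed.Build A A^o Kva Kva_closed).
apply: essv => b Nb vb.
have Nvb : b \in Nv by rewrite inE Nb.
apply: (N0 _ Nb); rewrite inE scalerDr (eqP vb) addr0 scalerA.
suff -> : (b : A) * a = 0 by rewrite scale0r.
apply: (essu Nva); last by apply/asboolP; exists b.
move=> _ /asboolP[c /andP[Nc vc] ->]; rewrite inE => uc.
rewrite (N0 c) ?mul0r// inE scalerDr (eqP vc) addr0 scalerA.
exact: uc.
Qed.

Definition Sing (V : lmodType A) : submodClosed V :=
  HB.pack (@Sing_pred V)
    (GRing.isSubmodClosed.Build A V (@Sing_pred V) (Sing_submod_closed V)).

Definition singular (V : lmodType A) : Prop := forall v : V, v \in Sing V.

Definition nonsingular (V : lmodType A) : Prop :=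
  forall v : V, v \in Sing V -> v = 0.

Definition Bassian (V : lmodType A) : Prop :=
  forall N : submodClosed V,
    (exists f : {linear V -> quotmod N}, injective f) ->
    forall v, v \in N -> v = 0.

Definition hereditarily_Bassian (V : lmodType A) : Prop :=
  forall S : submodClosed V, Bassian (submod S).

End ModuleNotions.

(* Product of additive subsets of a ring: the finite sums of products. *)
Definition set_prod {A : nzRingType} (S T : set A) : set A :=
  [set z | exists (n : nat) (x y : 'I_n -> A),
    [/\ forall i, S (x i), forall i, T (y i) & z = \sum_(i < n) x i * y i]].

(* Two-sided ideals. *)
Record ideal (R : nzRingType) := Ideal {
  ideal_pred :> {pred R};
  ideal_left_closed : submod_closed (ideal_pred : {pred R^o});
  ideal_right_closed : submod_closed (ideal_pred : {pred (R^c)^o})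
}.

Section Ideals.
Context {R : nzRingType}.
Implicit Types (I P : ideal R) (M : lmodType R^c).

Definition ideal_zero I : Prop := forall x : R, x \in I -> x = 0.

(* The power P ^ n, with P ^ 0 = R. *)
Fixpoint ideal_pow P (n : nat) : set R :=
  if n is m.+1 then set_prod (ideal_pow P m) [set` P] else setT.

Lemma ideal_powMl P n (a x : R) : ideal_pow P n x -> ideal_pow P n (a * x).
Proof.
elim: n x => //= n IHn _ [k] [x] [y] [Px Py ->].
exists k, (fun i => a * x i), y; split=> // [i|]; first exact: IHn.
by rewrite mulr_sumr; apply: eq_bigr => i _; rewrite mulrA.
Qed.

Lemma ideal_powS P n (x : R) : ideal_pow P n.+1 x -> ideal_pow P n x.
Proof.
elim: n x => // n IHn _ [k] [x] [y] [Px Py ->].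
by exists k, x, y; split=> // i; exact: IHn (Px i).
Qed.

Lemma ideal_pow_le P m n (x : R) :
  (m <= n)%N -> ideal_pow P n x -> ideal_pow P m x.
Proof.
move=> /subnK <-; elim: (n - m)%N => //= k IHk Px.
exact/IHk/ideal_powS.
Qed.

Definition primary_pred P M : {pred M} :=
  [pred x | `[< exists2 n, (1 <= n)%N &
      forall p : R, ideal_pow P n p -> (p : R^c) *: x = 0 >]].

Lemma primary_submod_closed P M : submod_closed (@primary_pred P M).
Proof.
split=> [|a x y].
  by apply/asboolP; exists 1%N => // p _; rewrite scaler0.
move=> /asboolP[m m1 Px] /asboolP[n n1 Py]; apply/asboolP.
exists (maxn m n); first by rewrite (leq_trans m1) ?leq_maxl.
move=> p Pp; rewrite scalerDr scalerA Py ?addr0; last first.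
  by apply: ideal_pow_le Pp; rewrite leq_maxr.
by apply: Px; apply: ideal_powMl; apply: ideal_pow_le Pp; rewrite leq_maxl.
Qed.

(* The P-primary component M(P). *)
Definition primary P M : submodClosed M :=
  HB.pack (@primary_pred P M)
    (GRing.isSubmodClosed.Build R^c M (@primary_pred P M)
       (primary_submod_closed P M)).

End Ideals.

Definition left_hereditary (A : nzRingType) : Prop :=
  forall I : submodClosed A^o, projective (submod I).

Definition left_noetherian (A : nzRingType) : Prop := @noetherian A A^o.

Definition left_primitive (A : nzRingType) : Prop :=
  exists V : lmodType A, simple_module V /\ faithful_module V.

Definition prime_ring (R : nzRingType) : Prop :=
  forall I J : ideal R,
    set_prod [set` I] [set` J] `<=` [set 0] -> ideal_zero I \/ ideal_zero J.

Definition HNP (R : nzRingType) : Prop :=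
  [/\ left_hereditary R /\ left_hereditary R^c,
      left_noetherian R /\ left_noetherian R^c & prime_ring R].

Definition nonprimitive (R : nzRingType) : Prop :=
  ~ left_primitive R /\ ~ left_primitive R^c.

Section Fractions.
Context {R : nzRingType} {Q : unitRingType} (iota : {rmorphism R -> Q}).
Implicit Types I P : ideal R.

Definition regular_elt (s : R) : Prop := GRing.lreg s /\ GRing.rreg s.

(* Q is the two-sided classical ring of fractions of R, R being embedded in Q
   by iota. *)
Definition classical_fractions : Prop :=
  [/\ injective iota,
      forall s : R, regular_elt s -> iota s \is a GRing.unit,
      forall q : Q, exists a s : R,
        regular_elt s /\ q = iota a * (iota s)^-1
    & forall q : Q, exists a s : R,
        regular_elt s /\ q = (iota s)^-1 * iota a].

Definition subbimodule (J : set Q) : Prop :=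
  [/\ J 0, forall x y, J x -> J y -> J (x + y),
      forall (r : R) x, J x -> J (iota r * x)
    & forall (r : R) x, J x -> J (x * iota r)].

Definition invertible_ideal I : Prop :=
  exists J : set Q,
    [/\ subbimodule J,
        set_prod (iota @` [set` I]) J = range iota
      & set_prod J (iota @` [set` I]) = range iota].

Definition proper_invertible I : Prop := 1 \notin I /\ invertible_ideal I.

Definition maximal_invertible P : Prop :=
  proper_invertible P /\
  forall I, proper_invertible I -> {subset P <= I} -> I =i P.

Definition Dedekind_prime : Prop :=
  [/\ HNP R, classical_fractions
    & forall I, ~ ideal_zero I -> invertible_ideal I].

End Fractions.

(* Main.v *)
Require Import Defs.
From HB Require Import structures.
From mathcomp Require Import all_boot all_order all_algebra.
From mathcomp Require Import boolp classical_sets.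

Set Implicit Arguments.
Unset Strict Implicit.
Unset Printing Implicit Defensive.

Import GRing.Theory.
Local Open Scope ring_scope.
Local Open Scope quotient_scope.

(** Write [V P] for the product of a right module with an ideal, and call a
    module [P]-primary if each of its elements is killed by a power of [P].

    Necessity. If [V] contains an independent sequence of elements [y_0, y_1, ...]
    with one common proper annihilator, then [y_i |-> y_(i+1)] embeds the
    submodule they generate into its quotient by [y_0 R], so [V] is not
    hereditarily Bassian ([no_independent_sequence]). This is used three times.

    - In a prime right noetherian ring choose [a <> 0] with maximal annihilator;
      every nonzero right ideal contains some [v a] with the same annihilator as
      [a]. If no finitely generated [G] has singular quotient in [M], one builds
      an independent sequence of copies of [a R] greedily
      ([strongly_Bassian_cosingular]).

    - In the [P]-primary component [V] of the singular submodule of [M], the socle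
      [{x | x P = 0}] is a sum of copies of a single simple module. So it is
      finitely generated ([acc_on_socle]), and the intersections of the socle
      with the [V P^k] become stationary ([dcc_on_socle]).

    By the second point [D = V P^k] satisfies [D P = D] for some [k]. Over a
    Dedekind prime ring such a module is injective relative to primary modules
    ([divisible_extension]). If [D <> 0], take a simple submodule [y R] of [D];
    the quotient [D / y R] is again divisible and its socle contains a copy of the
    socle of [D], which gives an embedding of [D] in [D / y R]
    ([divisible_primary_zero]). So [D = 0], that is, [V] is killed by [P^k]; and
    the modules killed by [P^k] whose socle is noetherian are noetherian
    ([acc_on_killed]), because submodules [X <= Y] with [X P = Y P] and the same
    socle are equal ([mul_ideal_cancel]). Finally, [G] can be replaced by a
    maximal nonsingular submodule of it ([nonsingular_cosingular]).

    Sufficiency. Let [V] be a submodule of [M], let [f : V -> V / N] be injective and let [pi : V -> V / N] be the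
    projection. The submodules [0], [N], [pi^-1 (f N)], ... form an ascending chain
    whose factors are all isomorphic to [N]. Intersected with [G] the chain is
    stationary, so its factors are subquotients of [M / G], and [N] is singular.
    If [N <> 0], then [N] has a nonzero element killed by some maximal invertible
    [P]; lifting it along the chain and taking [P]-components contradicts the
    ascending chain condition in the [P]-primary component ([Bassian_of_acc]).

    On the side of the ring, the necessity rests on the fact that a homomorphism
    on a right ideal containing an invertible ideal [C], with values in [Y C], is
    the action of an element of [Y] ([hom_inner]). The sufficiency rests on the
    fact that essential right ideals contain nonzero ideals
    ([essential_bounded]); here non-primitivity enters, through the simple
    submodules of the modules [R / E], with [E] an essential right ideal, which
    are found by a duality argument ([essential_cover]). *)

(** * Submodules, spans and chain conditions *)
Section Submodules.
Context {A : nzRingType} {V : lmodType A}.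
Implicit Types (S Z : V -> Prop) (N L : submodClosed V).

Definition submodule_prop S : Prop :=
  S 0 /\ forall a u v, S u -> S v -> S (a *: u + v).

Definition submodule_pred S : {pred V} := [pred v | `[< S v >]].

Lemma submodule_prop_closed S :
  submodule_prop S -> submod_closed (submodule_pred S).
Proof.
case=> S0 SD; split=> [|a u v]; first exact/asboolP.
by move=> /asboolP Su /asboolP Sv; apply/asboolP/SD.
Qed.

Definition mksub S (hS : submodule_prop S) : submodClosed V :=
  HB.pack (submodule_pred S)
    (GRing.isSubmodClosed.Build A V (submodule_pred S)
      (submodule_prop_closed hS)).

Lemma mksubP S (hS : submodule_prop S) v : reflect (S v) (v \in mksub hS).
Proof. exact: asboolP. Qed.

Lemma submod_comb N a u v : u \in N -> v \in N -> a *: u + v \in N.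
Proof. by move=> Nu Nv; rewrite rpredD ?rpredZ. Qed.

Lemma submodN N u : u \in N -> - u \in N.
Proof. by move=> Nu; rewrite -scaleN1r rpredZ. Qed.

Lemma submodB N u v : u \in N -> v \in N -> u - v \in N.
Proof. by move=> Nu Nv; rewrite rpredD ?submodN. Qed.

Lemma sum_sub_subproof N L :
  submodule_prop (fun v => exists2 u, u \in N & v - u \in L).
Proof.
split=> [|a u v [u' Nu Lu] [v' Nv Lv]].
  by exists 0; rewrite ?subr0 rpred0.
exists (a *: u' + v'); first exact: submod_comb.
have -> : a *: u + v - (a *: u' + v') = a *: (u - u') + (v - v').
  by rewrite scalerBr opprD addrACA.
exact: submod_comb.
Qed.

Definition sum_sub N L : submodClosed V := mksub (sum_sub_subproof N L).

Lemma sum_subP N L v :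
  reflect (exists2 u, u \in N & v - u \in L) (v \in sum_sub N L).
Proof. exact: mksubP. Qed.

Lemma cyc_sub_subproof (x : V) :
  submodule_prop (fun v => exists a : A, v = a *: x).
Proof.
split=> [|a _ _ [b ->] [c ->]]; first by exists 0; rewrite scale0r.
by exists (a * b + c); rewrite scalerDl scalerA.
Qed.

Definition cyc_sub (x : V) : submodClosed V := mksub (cyc_sub_subproof x).

Lemma zero_sub_subproof : submodule_prop (fun v : V => v = 0).
Proof. by split=> // a _ _ -> ->; rewrite scaler0 addr0. Qed.

Definition zero_sub : submodClosed V := mksub zero_sub_subproof.

Lemma full_sub_subproof : submodule_prop (fun v : V => True).
Proof. by []. Qed.

Definition full_sub : submodClosed V := mksub full_sub_subproof.

Lemma sum_subl N L v : v \in N -> v \in sum_sub N L.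
Proof. by move=> Nv; apply/mksubP; exists v; rewrite // subrr rpred0. Qed.

Lemma sum_subr N L v : v \in L -> v \in sum_sub N L.
Proof. by move=> Nv; apply/mksubP; exists 0; rewrite ?rpred0 // subr0. Qed.

Lemma cyc_subP x v : reflect (exists a : A, v = a *: x) (v \in cyc_sub x).
Proof. exact: mksubP. Qed.

Lemma cyc_sub_self x : x \in cyc_sub x.
Proof. by apply/cyc_subP; exists 1; rewrite scale1r. Qed.

Lemma in_full v : v \in full_sub.
Proof. exact/mksubP. Qed.

(** Spans of finite sequences are described one generator at a time, so that
    statements about them are proved by induction on the sequence. *)
Fixpoint in_gen (s : seq V) (v : V) : Prop :=
  if s is x :: s' then exists a : A, in_gen s' (v - a *: x) else v = 0.

Lemma in_gen_submodule s : submodule_prop (in_gen s).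
Proof.
elim: s => [|x s [IH0 IH]] /=; first exact: zero_sub_subproof.
split=> [|a u v [b Hu] [c Hv]]; first by exists 0; rewrite scale0r subr0.
exists (a * b + c).
have -> : a *: u + v - (a * b + c) *: x = a *: (u - b *: x) + (v - c *: x).
  by rewrite scalerBr scalerDl opprD addrACA scalerA.
exact: IH.
Qed.

Definition gen_sub s : submodClosed V := mksub (in_gen_submodule s).

Lemma gen_cons s x v : v \in gen_sub s -> v \in gen_sub (x :: s).
Proof. by move=> /mksubP sv; apply/mksubP; exists 0; rewrite scale0r subr0. Qed.

Lemma gen_head s x : x \in gen_sub (x :: s).
Proof.
by apply/mksubP; exists 1; rewrite scale1r subrr; case: (in_gen_submodule s).
Qed.

Lemma gen_least s N : (forall x, x \in s -> x \in N) -> {subset gen_sub s <= N}.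
Proof.
elim: s => [|x s IH] sN v /mksubP; first by move=> ->; rewrite rpred0.
case=> a /(mksubP (in_gen_submodule s)) Hv.
have {}IH : {subset gen_sub s <= N} by apply: IH => y ys; rewrite sN ?inE ?ys ?orbT.
have Nx : x \in N by apply: sN; rewrite mem_head.
by rewrite -(subrK (a *: x) v) rpredD ?rpredZ // IH.
Qed.

Lemma mem_gen s x : x \in s -> x \in gen_sub s.
Proof.
elim: s => // y s IH; rewrite inE => /predU1P[->|/IH]; first exact: gen_head.
exact: gen_cons.
Qed.

Lemma gen_sum s v : v \in gen_sub s ->
  exists c : nat -> A, v = \sum_(i < size s) c i *: s`_i.
Proof.
elim: s v => [|x s IH] v /mksubP; first by move=> ->; exists (fun=> 0); rewrite big_ord0.
case=> a /(mksubP (in_gen_submodule s))/IH[c vE].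
exists (fun i => if i is j.+1 then c j else a).
by rewrite big_ord_recl /= -vE addrC subrK.
Qed.

(** The ascending chain condition for the submodules lying inside [Z]; it
    lets chains of submodules of a big module be cut down to a noetherian
    piece without changing the ambient module. *)
Definition acc_on Z : Prop :=
  forall N : nat -> submodClosed V, (forall i, {subset N i <= N i.+1}) ->
    exists n, forall m, (n <= m)%N -> forall v, Z v -> v \in N m -> v \in N n.

Lemma chain_le (N : nat -> submodClosed V) :
  (forall i, {subset N i <= N i.+1}) ->
  forall m n, (m <= n)%N -> {subset N m <= N n}.
Proof.
move=> HN m n /subnK <-; elim: (n - m)%N => //= k IH v /IH; exact: HN.
Qed.

Lemma noetherian_acc : noetherian V <-> acc_on (fun=> True).
Proof.
split=> H N HN; have [n Hn] := H N HN; exists n => m nm.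
  by move=> v _; rewrite (Hn m nm).
move=> v; apply/idP/idP; first exact: Hn.
exact: (chain_le HN).
Qed.

Lemma acc_max Z (F : submodClosed V -> Prop) (N0 : submodClosed V) :
  acc_on Z -> F N0 -> (forall N, F N -> forall v, v \in N -> Z v) ->
  exists N, F N /\ forall L, F L -> {subset N <= L} -> {subset L <= N}.
Proof.
move=> accZ FN0 FZ; apply: contrapT => Hno.
have step (N : {N | F N}) : exists L : {N | F N},
    {subset sval N <= sval L} /\ ~ {subset sval L <= sval N}.
  apply: contrapT => Hn; apply: Hno; exists (sval N); split=> [|L FL NL].
    exact: (svalP N).
  apply: contrapT => HL; apply: Hn.
  by exists (exist F L FL).
have [nxt Hnxt] := choice step.
pose N k := sval (iter k nxt (exist F N0 FN0)).
have Nup i : {subset N i <= N i.+1} by case: (Hnxt (iter i nxt (exist F N0 FN0))).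
have [n Hn] := accZ N Nup.
have [_ []] := Hnxt (iter n nxt (exist F N0 FN0)).
move=> v Hv; apply: (Hn n.+1) => //; apply: FZ (Hv).
exact: (svalP (iter n.+1 nxt (exist F N0 FN0))).
Qed.

End Submodules.

Arguments zero_sub {A V}.
Arguments full_sub {A V}.

(** * Finite generation over noetherian rings *)

Section FinitelyGenerated.
Context {A : nzRingType}.

Lemma finitely_generated_gen (V : lmodType A) :
  finitely_generated V <-> exists s : seq V, forall v, v \in gen_sub s.
Proof.
split=> [[n [g Hg]]|[s Hs]].
  exists [seq g i | i <- enum 'I_n] => v; have [c ->] := Hg v.
  by apply: rpred_sum => i _; rewrite rpredZ // mem_gen // map_f // mem_enum.
exists (size s), (fun i => s`_i) => v.
by have [c ->] := gen_sum (Hs v); exists c.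
Qed.

Lemma gen_map (U V : lmodType A) (f : {linear U -> V}) s u :
  u \in gen_sub s -> f u \in gen_sub (map f s).
Proof.
elim: s u => [|x s IH] u /mksubP; first by move=> ->; rewrite linear0 rpred0.
case=> a /(mksubP (in_gen_submodule s))/IH H.
apply/mksubP; exists a; apply/(mksubP (in_gen_submodule _)).
by rewrite -linearZZ -linearB.
Qed.

Lemma finitely_generated_submod (V : lmodType A) (N : submodClosed V) :
  finitely_generated (submod N) <-> exists s : seq V, N =i gen_sub s.
Proof.
split=> [/finitely_generated_gen[s Hs]|[s Hs]].
  exists (map val s) => v; apply/idP/idP => [Nv|].
    exact: (@gen_map _ _ (\val : {linear submod N -> V}) s (Submod Nv)).
  apply: gen_least => _ /mapP[x _ ->]; exact: valP.
have sN (i : 'I_(size s)) : s`_i \in N by rewrite Hs mem_gen // mem_nth.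
exists (size s), (fun i => Submod (sN i)) => v.
have := valP v; rewrite /= Hs => /gen_sum[c Hc]; exists c; apply: val_inj.
rewrite linear_sum /= Hc; exact: eq_bigr.
Qed.

(** Hilbert's argument: along a chain of submodules, the leading coefficients
    with respect to the first generator form a chain of left ideals. *)
Lemma acc_gen (V : lmodType A) (s : seq V) :
  left_noetherian A -> acc_on (fun v => v \in gen_sub s).
Proof.
move=> nA; elim: s => [|x s IH] N HN.
  by exists 0%N => m _ v /mksubP -> _; rewrite rpred0.
pose Ik k (a : A^o) := exists2 w, w \in gen_sub s & (a : A) *: x + w \in N k.
have Ik_sub k : submodule_prop (Ik k).
  split=> [|a u v [u' su Nu] [v' sv Nv]].
    by exists 0; rewrite ?scale0r ?addr0 rpred0.
  exists (a *: u' + v'); first exact: submod_comb.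
  have -> : (a *: u + v) *: x + (a *: u' + v') =
      a *: ((u : A) *: x + u') + ((v : A) *: x + v').
    by rewrite scalerDl -scalerA scalerDr addrACA.
  exact: submod_comb.
have [|n1 Hn1] := nA (fun k => mksub (Ik_sub k)).
  by move=> k a /mksubP[w sw Nw]; apply/mksubP; exists w; last exact: HN.
have [n2 Hn2] := IH N HN.
exists (maxn n1 n2) => m; rewrite geq_max => /andP[n1m n2m] v.
move=> /mksubP[a /(mksubP (in_gen_submodule s)) sv] Nv.
have /mksubP[w' sw' Nw'] : (a : A^o) \in mksub (Ik_sub n1).
  rewrite -(Hn1 m n1m); apply/mksubP; exists (v - a *: x) => //.
  by rewrite addrC subrK.
have Nn w : w \in N n1 \/ w \in N n2 -> w \in N (maxn n1 n2).
  by case; apply: chain_le; rewrite // (leq_maxl, leq_maxr).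
have -> : v = (a *: x + w') + (v - (a *: x + w')) by rewrite addrC subrK.
rewrite rpredD //; apply: Nn; [by left | right; apply: (Hn2 m) => //].
  by rewrite opprD addrA submodB.
by rewrite submodB // (chain_le HN n1m).
Qed.

Lemma finitely_generated_noetherian (V : lmodType A) :
  left_noetherian A -> finitely_generated V -> noetherian V.
Proof.
move=> nA /finitely_generated_gen[s Hs]; apply/noetherian_acc => N HN.
by have [n Hn] := acc_gen s nA HN; exists n => m nm v _; apply: Hn.
Qed.

Lemma acc_on_fg (V : lmodType A) (Z : V -> Prop) (N : submodClosed V) :
  acc_on Z -> (forall v, v \in N -> Z v) -> exists s, N =i gen_sub s.
Proof.
move=> accZ NZ.
pose F (L : submodClosed V) := {subset L <= N} /\ exists s, L =i gen_sub s.
have [||L [[LN [s Ls]] Lmax]] := acc_max (F := F) (N0 := zero_sub) accZ.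
- split; first by move=> v /mksubP ->; rewrite rpred0.
  by exists [::].
- by move=> L [LN _] v /LN/NZ.
exists s => v; apply/idP/idP; last by rewrite -Ls; apply: LN.
move=> Nv; rewrite -Ls; apply: (Lmax (gen_sub (v :: s))); last exact: gen_head.
  split; last by exists (v :: s).
  apply: gen_least => x; rewrite inE => /predU1P[->//|xs].
  by apply: LN; rewrite Ls mem_gen.
by move=> w; rewrite Ls; apply: gen_cons.
Qed.

Lemma noetherian_finitely_generated (V : lmodType A) :
  noetherian V -> finitely_generated V.
Proof.
move=> /noetherian_acc nV.
have [//|s Hs] := @acc_on_fg V (fun=> True) full_sub nV.
by apply/finitely_generated_gen; exists s => v; rewrite -Hs in_full.
Qed.

Lemma acc_on_preim (T U V : lmodType A) (i : {linear T -> V})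
    (j : {linear U -> V}) :
  injective j -> noetherian T -> acc_on (fun u => exists t, i t = j u).
Proof.
move=> j_inj nT L HL.
pose Lk k (t : T) := exists2 u, u \in L k & i t = j u.
have Lk_sub k : submodule_prop (Lk k).
  split=> [|a v w [v' Lv Hv] [w' Lw Hw]].
    by exists 0; rewrite ?rpred0 // !linear0.
  exists (a *: v' + w'); first exact: submod_comb.
  by rewrite !linearP Hv Hw.
have [|n Hn] := nT (fun k => mksub (Lk_sub k)).
  by move=> k v /mksubP[u Lu Hu]; apply/mksubP; exists u; first exact: HL.
exists n => m nm u [t tu] Lu.
have : t \in mksub (Lk_sub m) by apply/mksubP; exists u.
by rewrite Hn // => /mksubP[w Lw]; rewrite tu => /j_inj ->.
Qed.

End FinitelyGenerated.

(** A map on a submodule is carried as a total function with linearity required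
    on the submodule only; extending and restricting it is then free. *)
Definition lin_on {A : nzRingType} {V W : lmodType A} (N : submodClosed V)
    (f : V -> W) : Prop :=
  forall a u v, u \in N -> v \in N -> f (a *: u + v) = a *: f u + f v.

Section LinOn.
Context {A : nzRingType} {V W : lmodType A} (N : submodClosed V) (f : V -> W).
Hypothesis fN : lin_on N f.

Lemma lin_on0 : f 0 = 0.
Proof.
have := fN (-1) (rpred0 N) (rpred0 N).
by rewrite scaler0 addr0 scaleN1r addNr.
Qed.

Lemma lin_onZ a u : u \in N -> f (a *: u) = a *: f u.
Proof. by move=> Nu; have := fN a Nu (rpred0 N); rewrite !addr0 lin_on0 addr0. Qed.

Lemma lin_onD u v : u \in N -> v \in N -> f (u + v) = f u + f v.
Proof. by move=> Nu Nv; have := fN 1 Nu Nv; rewrite !scale1r. Qed.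

Lemma lin_on_sum (I : Type) (r : seq I) (P : pred I) (F : I -> V) :
  (forall i, P i -> F i \in N) ->
  f (\sum_(i <- r | P i) F i) = \sum_(i <- r | P i) f (F i).
Proof.
move=> NF; elim: r => [|i r IH]; first by rewrite !big_nil lin_on0.
rewrite !big_cons; case: ifP => // Pi; rewrite lin_onD ?NF ?IH //.
exact: rpred_sum.
Qed.

End LinOn.

Lemma linear_of_rel (A : nzRingType) (V W : lmodType A) (rho : V -> W -> Prop) :
  (forall a u v x y, rho u x -> rho v y -> rho (a *: u + v) (a *: x + y)) ->
  (forall x, rho 0 x -> x = 0) -> (forall u, exists x, rho u x) ->
  exists f : {linear V -> W}, forall u, rho u (f u).
Proof.
move=> rhoP rho0 tot; have [f fP] := choice tot.
have lin : linear f.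
  move=> a u v.
  have := rhoP (-1) _ _ _ _ (rhoP a _ _ _ _ (fP u) (fP v)) (fP (a *: u + v)).
  by rewrite !scaleN1r addNr => /rho0/eqP; rewrite addr_eq0 eqr_opp => /eqP ->.
pose fl : {linear V -> W} := HB.pack f (GRing.isLinear.Build _ _ _ _ f lin).
by exists fl.
Qed.

(** * Quotients, singular elements and projective left ideals *)

Section Quotients.
Context {A : nzRingType} {V : lmodType A} (N : submodClosed V).

Lemma quot_pi_eq u v : (\pi_(quotmod N) u = \pi_(quotmod N) v) <-> u - v \in N.
Proof.
rewrite -[_ \in N]/(_ \in submod_zmod N) Quotient.idealrBE.
by split=> [->|/eqP].
Qed.

Lemma quot_pi0 v : (\pi_(quotmod N) v = 0) <-> v \in N.
Proof.
rewrite -(linear0 (\pi_(quotmod N))) -[X in X \in N]subr0; exact: quot_pi_eq.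
Qed.

Lemma quot_piW (x : quotmod N) : exists v, x = \pi_(quotmod N) v.
Proof. by exists (repr x); rewrite reprK. Qed.

End Quotients.

Section Singular.
Context {A : nzRingType}.
Implicit Types (V : lmodType A) (E : A -> Prop).

(** An elementwise form of essentiality, which makes sense for predicates that
    are not packaged as submodules. *)
Definition ess E : Prop := forall x : A, x != 0 -> exists2 r, r * x != 0 & E (r * x).

Lemma essentialP (E : {pred A^o}) : essential E <-> ess (fun x => x \in E).
Proof.
split=> [esE x x0|esE N NE v Nv].
  apply: contrapT => Hno; case/negP: x0; apply/eqP.
  apply: (esE (cyc_sub (x : A^o))); last exact: cyc_sub_self.
  move=> _ /cyc_subP[a ->] Ex; apply: contrapT => /eqP ax.
  by apply: Hno; exists a.
apply: contrapT => /eqP/esE[r /eqP rv Er]; apply: rv.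
by apply: (NE _ _ Er); exact: (rpredZ r Nv).
Qed.

Lemma ess_sub E E' : ess E -> (forall x, E x -> E' x) -> ess E'.
Proof. by move=> esE EE' x /esE[r r0 /EE']; exists r. Qed.

Lemma SingP V (v : V) : (v \in Sing V) <-> ess (fun x => x *: v = 0).
Proof.
rewrite -[_ \in _]/(`[< essential (ann v) >]).
split=> [/asboolP/essentialP H|H].
  apply: (ess_sub H) => x. exact: eqP.
apply/asboolP/essentialP; apply: (ess_sub H) => x /eqP.
exact.
Qed.

Lemma Sing_quotP V (N : submodClosed V) v :
  (\pi_(quotmod N) v \in Sing (quotmod N)) <-> ess (fun x => x *: v \in N).
Proof.
split=> [/SingP H|H]; last apply/SingP; apply: (ess_sub H) => x.
  by rewrite -linearZZ => /quot_pi0.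
by rewrite -linearZZ => Nx; apply/quot_pi0.
Qed.

Lemma singular_quotP V (N : submodClosed V) :
  singular (quotmod N) <-> forall v, ess (fun x => x *: v \in N).
Proof.
split=> H v; first exact/Sing_quotP.
by have [w ->] := quot_piW v; apply/Sing_quotP.
Qed.

Lemma Sing_inj V (W : lmodType A) (j : {linear V -> W}) v :
  injective j -> (v \in Sing V) <-> (j v \in Sing W).
Proof.
move=> j_inj; split=> /SingP H; apply/SingP; apply: (ess_sub H) => x.
  by rewrite -linearZZ => ->; rewrite linear0.
by rewrite -linearZZ -(linear0 j) => /j_inj.
Qed.

Lemma ess_transporter (E : submodClosed A^o) e :
  ess (fun x => (x : A^o) \in E) -> ess (fun x => (x * e : A^o) \in E).
Proof.
move=> esE x x0; have [xe|xe] := eqVneq (x * e) 0.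
  by exists 1; rewrite mul1r // xe rpred0.
have [r rxe Er] := esE _ xe; exists r; last by rewrite -mulrA.
by apply: contraNneq rxe => rx; rewrite mulrA rx mul0r.
Qed.

Section NonsingularRing.
Hypothesis nsA : nonsingular (A^o : lmodType A).

Lemma nonsing_eq0 (E : A -> Prop) (x : A) :
  ess E -> (forall r, E r -> r * x = 0) -> x = 0.
Proof. by move=> esE Ex; apply: nsA; apply/SingP; apply: (ess_sub esE) => r /Ex. Qed.

(** The singular torsion theory is closed under extensions, because an
    essential left ideal of a nonsingular ring kills no nonzero element. *)
Lemma ess_trans (E E' : A -> Prop) :
  ess E -> (forall x, E x -> ess (fun s => E' (s * x))) -> ess E'.
Proof.
move=> esE EE' x /esE[r rx Er]; apply: contrapT => Hno.
case/negP: rx; apply/eqP; apply: nonsing_eq0 (EE' _ Er) _ => s Es.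
by apply: contrapT => /eqP srx; apply: Hno; exists (s * r); rewrite -mulrA.
Qed.

Lemma Sing_closed V v : ess (fun x => x *: v \in Sing V) -> v \in Sing V.
Proof.
move=> H; apply/SingP; apply: (ess_trans H) => x /SingP Hx.
by apply: (ess_sub Hx) => s; rewrite scalerA.
Qed.

End NonsingularRing.

(** The dual basis lemma, obtained by splitting the map onto [I] from the free
    module on finitely many generators. *)
Lemma dual_basis (I : submodClosed A^o) :
  left_hereditary A -> left_noetherian A ->
  exists n (x : 'I_n -> A) (f : 'I_n -> A^o -> A^o),
    [/\ forall i, (x i : A^o) \in I, forall i, lin_on I (f i)
      & forall v, v \in I -> v = \sum_(i < n) (f i v : A) * x i].
Proof.
move=> hA nA.
have [s Hs] := acc_on_fg (N := I) (iffLR noetherian_acc nA) (fun _ _ => Logic.I).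
have sI (i : 'I_(size s)) : s`_i \in I by rewrite Hs mem_gen // mem_nth.
pose x (i : 'I_(size s)) : submod I := Submod (sI i).
pose g0 (c : 'rV[A]_(size s)) := \sum_(i < size s) c 0 i *: x i.
have g0_lin : linear g0.
  move=> a u v; rewrite /g0 scaler_sumr -big_split; apply: eq_bigr => i _.
  by rewrite !mxE scalerDl scalerA.
pose g : {linear 'rV[A]_(size s) -> submod I} :=
  HB.pack g0 (GRing.isLinear.Build _ _ _ _ g0 g0_lin).
have g_surj v : exists c, g c = v.
  have := valP v; rewrite /= Hs => /gen_sum[c Hc].
  exists (\row_i c i); apply: val_inj.
  rewrite linear_sum /= Hc.
  by apply: eq_bigr => i _; rewrite mxE.
have [h Hh] := hA I _ _ g (idfun : {linear submod I -> submod I}) g_surj.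
pose f i (v : A^o) : A^o := if insub v is Some w then h w 0 i else 0.
have fE v (Iv : v \in I) i : f i v = h (Submod Iv) 0 i.
  by rewrite /f (insubT (fun v => v \in I) Iv).
exists (size s), (fun i => s`_i), f; split=> // [i a u v Iu Iv|v Iv].
  rewrite (fE _ Iu) (fE _ Iv) (fE _ (submod_comb a Iu Iv)).
  have -> : Submod (submod_comb a Iu Iv) = a *: Submod Iu + Submod Iv.
    exact: val_inj.
  by rewrite linearP !mxE.
have := congr1 val (Hh (Submod Iv)); rewrite linear_sum /= => {1}<-.
by apply: eq_bigr => i _; rewrite fE.
Qed.

(** For [x = sum f_i(x) b_i] with [b_i = c_i x], the element [e = sum f_i(x) c_i]
    satisfies [e x = x] and is killed by the annihilator of [x]. *)
Lemma hereditary_nonsingular :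
  left_hereditary A -> left_noetherian A -> nonsingular (A^o : lmodType A).
Proof.
move=> hA nA x /SingP esx.
have [n [b [f [bI fl xE]]]] := dual_basis (cyc_sub (x : A^o)) hA nA.
have Ix := cyc_sub_self (x : A^o).
have {}bI i : exists c : A, b i = c * x by apply/(cyc_subP (x : A^o)).
have [c cE] := choice bI.
pose e := \sum_(i < n) (f i x : A) * c i.
have ex : e * x = x.
  by rewrite [RHS](xE _ Ix) mulr_suml; apply: eq_bigr => i _; rewrite cE mulrA.
have re r : r * x = 0 -> r * e = 0.
  move=> rx; rewrite mulr_sumr big1 // => i _; rewrite mulrA.
  have := lin_onZ (fl i) r Ix.
  rewrite -[r *: (x : A^o)]/(r * x) rx (lin_on0 (fl i)) => H.
  by rewrite -[r * f i x]/(r *: (f i x : A^o)) -H mul0r.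
apply: contrapT => /eqP x0.
have e0 : e != 0 by apply: contraNneq x0 => e0; rewrite -ex e0 mul0r.
have [r /eqP re0] := esx _ e0.
by rewrite -[_ *: _]/(r * e * x) -mulrA ex => /re.
Qed.

End Singular.

(** * Bassian modules and independent sequences *)

Section Bassian.
Context {A : nzRingType}.

(** Every submodule [S] of [V] is Bassian, with a monomorphism from [S] into
    [S / N] presented by two maps with the same kernel, from a common module [F]
    onto [S] and into [V / N]. In this form no submodule of a submodule occurs,
    and [F] can be chosen free. *)
Definition strongly_Bassian (V : lmodType A) : Prop :=
  forall (F : lmodType A) (Phi : {linear F -> V}) (N : submodClosed V)
    (Psi : {linear F -> quotmod N}),
    (forall p, exists q, Psi p = \pi_(quotmod N) (Phi q)) ->
    (forall v, v \in N -> exists p, v = Phi p) ->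
    (forall p, Phi p = 0 <-> Psi p = 0) ->
    forall v, v \in N -> v = 0.

Lemma image_submodule (U V : lmodType A) (f : {linear U -> V}) :
  submodule_prop (fun v => exists u, v = f u).
Proof.
split=> [|a _ _ [u ->] [v ->]]; first by exists 0; rewrite linear0.
by exists (a *: u + v); rewrite linearP.
Qed.

Lemma hereditarily_Bassian_strongly (M V : lmodType A) (j : {linear V -> M}) :
  injective j -> hereditarily_Bassian M -> strongly_Bassian V.
Proof.
move=> j_inj hM F Phi N Psi imPsi imN kers v Nv.
pose jP : {linear F -> M} := j \o Phi.
pose S : submodClosed M := mksub (image_submodule jP).
have SP p : jP p \in S by apply/mksubP; exists p.
pose T (s : submod S) := exists2 u, u \in N & submod_val s = j u.
have T_sub : submodule_prop T.
  split=> [|a s t [u Nu Hu] [w Nw Hw]]; first by exists 0; rewrite ?rpred0 // !linear0.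
  exists (a *: u + w); first exact: submod_comb.
  by rewrite linearP -Hu -Hw.
pose N0 : submodClosed (submod S) := mksub T_sub.
pose rho (s : submod S) (x : quotmod N0) := exists p q,
  [/\ submod_val s = jP p, Psi p = \pi_(quotmod N) (Phi q)
    & x = \pi_(quotmod N0) (Submod (SP q))].
have piN0 q : (\pi_(quotmod N0) (Submod (SP q)) = 0) <-> Phi q \in N.
  rewrite quot_pi0; split=> [/mksubP[u Nu /j_inj -> //]|Nq].
  by apply/mksubP; exists (Phi q).
have rho0 x : rho 0 x -> x = 0.
  move=> [p [q [Hp Hq ->]]]; apply/piN0/quot_pi0; rewrite -Hq; apply/kers.
  by apply: j_inj; rewrite linear0 -[j _]Hp.
have [||f Hf] := @linear_of_rel A (submod S) (quotmod N0) rho _ rho0.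
- move=> a s t x y [p [q [Hp Hq ->]]] [p' [q' [Hp' Hq' ->]]].
  exists (a *: p + p'), (a *: q + q'); split.
  + by rewrite linearP -Hp -Hp'.
  + by rewrite !linearP Hq Hq'.
  + rewrite -linearP; congr (\pi_(quotmod N0) _); apply: val_inj.
    by rewrite /= !linearP.
- move=> s; have /mksubP[p Hp] := valP s; have [q Hq] := imPsi p.
  by exists (\pi_(quotmod N0) (Submod (SP q))), p, q.
have [p vE] := imN v Nv.
suff H : Submod (SP p) = 0.
  apply: j_inj; rewrite linear0 vE.
  by rewrite -[LHS]/(submod_val (Submod (SP p))) H.
apply: (hM S N0); last by apply/mksubP; exists v => //=; rewrite vE.
exists f; apply: raddf_inj => s fs.
have [p1 [q1 [Hp1 Hq1 Hs]]] := Hf s.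
have /piN0/quot_pi0 : \pi_(quotmod N0) (Submod (SP q1)) = 0 by rewrite -Hs.
rewrite -Hq1 => /kers Hp0; apply: val_inj.
by rewrite /= Hp1 /= Hp0 linear0.
Qed.

(** Shifting an infinite direct sum of copies of one cyclic module identifies it
    with its quotient by the first copy. Both the direct sum and the shift are
    images of the free module of polynomials. *)
Lemma no_independent_sequence (V : lmodType A) (y : nat -> V) (B : A -> Prop) :
  strongly_Bassian V -> y 0%N != 0 -> (forall n a, a *: y n = 0 <-> B a) ->
  ~ (forall n (c : nat -> A), \sum_(i < n) c i *: y i = 0 ->
       forall i, (i < n)%N -> c i *: y i = 0).
Proof.
move=> hV y0 yB indep.
pose comb (z : nat -> V) (p : {poly A}) := \sum_(i < size p) p`_i *: z i.
have combE z n (p : {poly A}) : (size p <= n)%N ->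
    comb z p = \sum_(i < n) p`_i *: z i.
  move=> pn; rewrite /comb (big_ord_widen n (fun i => p`_i *: z i) pn).
  rewrite big_mkcond; apply: eq_bigr => i _; case: ltnP => // ip.
  by rewrite nth_default // scale0r.
have comb_lin z : linear (comb z).
  move=> a p q; pose n := maxn (size p) (size q).
  have le1 : (size p <= n)%N by rewrite leq_maxl.
  have le2 : (size q <= n)%N by rewrite leq_maxr.
  have le3 : (size (a *: p + q)%R <= n)%N.
    rewrite (leq_trans (size_polyD _ _)) // geq_max le2 andbT.
    by rewrite (leq_trans (size_scale_leq _ _)).
  rewrite (combE _ n) // (combE _ n p) // (combE _ n q) // scaler_sumr -big_split.
  by apply: eq_bigr => i _; rewrite coefD coefZ scalerDl scalerA.
pose Phi z : {linear {poly A} -> V} :=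
  HB.pack (comb z) (GRing.isLinear.Build _ _ _ _ (comb z) (comb_lin z)).
pose N := cyc_sub (y 0%N).
pose Psi : {linear {poly A} -> quotmod N} := \pi_(quotmod N) \o Phi (fun n => y n.+1).
have shiftE p : comb y (p * 'X) = comb (fun n => y n.+1) p.
  rewrite (combE _ (size p).+1); last first.
    by rewrite (leq_trans (size_polyMleq _ _)) // size_polyX addn2.
  rewrite big_ord_recl coefMX /= scale0r add0r; apply: eq_bigr => i _.
  by rewrite coefMX.
have indep_poly p : comb y p = 0 -> forall i, B p`_i.
  move=> p0 i; apply/(yB i); have [ip|ip] := ltnP i (size p).
    exact: (indep (size p) (fun i => p`_i) p0).
  by rewrite nth_default // scale0r.
case/negP: y0; apply/eqP.
apply: (hV {poly A} (Phi y) N Psi); last exact: cyc_sub_self.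
- by move=> p; exists (p * 'X); rewrite /= shiftE.
- move=> _ /cyc_subP[a ->]; exists a%:P; rewrite /= (combE _ 1%N) ?size_polyC_leq1 //.
  by rewrite big_ord1 coefC.
move=> p; split=> [/indep_poly Bp|/quot_pi0/cyc_subP[a Ha]].
  by rewrite /= /comb big1 ?linear0 // => i _; apply/yB.
have /indep_poly Bp : comb y (p * 'X - a%:P) = 0.
  rewrite -[comb y _]/(Phi y _) linearB /= shiftE; rewrite /= in Ha; rewrite Ha.
  rewrite (combE _ 1%N) ?size_polyC_leq1 // big_ord1 coefC subrr //.
rewrite /= /comb big1 // => i _; apply/yB.
by have := Bp i.+1; rewrite coefB coefMX coefC subr0.
Qed.

(** Otherwise an independent sequence of good elements is built greedily. *)
Lemma strongly_Bassian_greedy (V : lmodType A) (good : V -> Prop) (B : A -> Prop) :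
  strongly_Bassian V ->
  (forall y, good y -> y != 0 /\ forall a, a *: y = 0 <-> B a) ->
  exists s : seq V, (forall x, x \in s -> good x) /\
    forall y, good y -> exists a, a *: y != 0 /\ a *: y \in gen_sub s.
Proof.
move=> hV goodB; apply: contrapT => Hno.
have step (s : {s : seq V | forall x, x \in s -> good x}) : exists y,
    good y /\ forall a, a *: y \in gen_sub (sval s) -> a *: y = 0.
  apply: contrapT => Hs; apply: Hno; exists (sval s); split; first exact: (svalP s).
  move=> y gy; apply: contrapT => Hy; apply: Hs; exists y; split=> // a ay.
  by apply: contrapT => /eqP ay0; apply: Hy; exists a.
have [nxt Hnxt] := choice step.
have good_nil (x : V) : x \in [::] -> good x by [].
have cons_good s : forall x, x \in nxt s :: sval s -> good x.
  move=> x; rewrite inE => /predU1P[->|]; first by case: (Hnxt s).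
  exact: (svalP s).
pose S n := iter n (fun s => exist _ (nxt s :: sval s) (cons_good s))
  (exist (fun s : seq V => forall x, x \in s -> good x) [::] good_nil).
pose y n := nxt (S n).
have SE n : sval (S n.+1) = y n :: sval (S n) by [].
have yS n i : (i < n)%N -> y i \in gen_sub (sval (S n)).
  elim: n => // n IH; rewrite ltnS leq_eqVlt => /predU1P[->|/IH].
    exact: (gen_head (sval (S n))).
  by move=> Hi; rewrite SE; apply: gen_cons.
apply: (@no_independent_sequence V y B hV).
- by case: (goodB (y 0%N)); first by case: (Hnxt (S 0%N)).
- by move=> n; case: (goodB (y n)); first by case: (Hnxt (S n)).
elim=> // n IH c; rewrite big_ord_recr /= => H.
have cn : c n *: y n = 0.
  have [_] := Hnxt (S n); apply.
  rewrite -[nxt _]/(y n); move/eqP: H; rewrite addrC addr_eq0 => /eqP ->.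
  by apply: submodN; apply: rpred_sum => i _; rewrite rpredZ // yS.
move: H; rewrite cn addr0 => /IH H i; rewrite ltnS leq_eqVlt.
by case/predU1P => [->|/H].
Qed.

End Bassian.

(** * Right modules and two-sided ideals *)

(** Naming the right action keeps the product of [R^c] out of computations. *)
Definition ract {R : nzRingType} {V : lmodType R^c} (v : V) (r : R) : V :=
  (r : R^c) *: v.
Notation "v <* r" := (ract v r) (at level 40, left associativity).

Section RightAction.
Context {R : nzRingType} {V : lmodType R^c}.
Implicit Types (u v : V) (r s : R) (N : submodClosed V).

Lemma scale_ract (a : R^c) v : a *: v = v <* a. Proof. by []. Qed.
Lemma ractA v r s : v <* r <* s = v <* (r * s).
Proof. exact: scalerA. Qed.
Lemma ract1 v : v <* 1 = v. Proof. exact: scale1r. Qed.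
Lemma ractr0 v : v <* 0 = 0. Proof. exact: scale0r. Qed.
Lemma ract0r r : (0 : V) <* r = 0. Proof. exact: scaler0. Qed.
Lemma ractDl u v r : (u + v) <* r = u <* r + v <* r. Proof. exact: scalerDr. Qed.
Lemma ractDr v r s : v <* (r + s) = v <* r + v <* s. Proof. exact: scalerDl. Qed.
Lemma ractBl u v r : (u - v) <* r = u <* r - v <* r. Proof. exact: scalerBr. Qed.
Lemma ractBr v r s : v <* (r - s) = v <* r - v <* s. Proof. exact: scalerBl. Qed.

Lemma ract_suml n (F : 'I_n -> V) r :
  (\sum_(i < n) F i) <* r = \sum_(i < n) F i <* r.
Proof. exact: scaler_sumr. Qed.

Lemma ract_sumr n (F : 'I_n -> R) v :
  v <* (\sum_(i < n) F i) = \sum_(i < n) v <* F i.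
Proof. exact: scaler_suml. Qed.

Lemma submod_ract N v r : v \in N -> v <* r \in N.
Proof. by move=> Nv; apply: rpredZ. Qed.

Lemma linear_ract (W : lmodType R^c) (f : {linear V -> W}) v r :
  f (v <* r) = f v <* r.
Proof. exact: linearZZ. Qed.

Lemma quot_pi_ract N v r :
  \pi_(quotmod N) (v <* r) = \pi_(quotmod N) v <* r.
Proof. exact: (linear_ract (\pi_(quotmod N))). Qed.

End RightAction.

Notation right_ideal R := (submodClosed ((R^c)^o)) (only parsing).

Lemma right_idealM (R : nzRingType) (N : right_ideal R) (x r : R) :
  (x : (R^c)^o) \in N -> (x * r : (R^c)^o) \in N.
Proof. by move=> Nx; rewrite -[x * r]/((r : R^c) *: (x : (R^c)^o)) rpredZ. Qed.

Section Ideals.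
Context {R : nzRingType}.
Implicit Types (I J P : ideal R).

Lemma ideal0 I : 0 \in I. Proof. by case: (ideal_left_closed I). Qed.

Lemma idealMl I a x : x \in I -> a * x \in I.
Proof.
case: (ideal_left_closed I) => I0 IM Ix.
by have := IM a x 0 Ix I0; rewrite addr0.
Qed.

Lemma idealMr I a x : x \in I -> x * a \in I.
Proof.
case: (ideal_right_closed I) => I0 IM Ix.
by have := IM a x 0 Ix I0; rewrite addr0.
Qed.

Lemma idealD I x y : x \in I -> y \in I -> x + y \in I.
Proof.
case: (ideal_left_closed I) => I0 IM Ix Iy.
by have := IM 1 x y Ix Iy; rewrite scale1r.
Qed.

Definition ideal_prop (S : R -> Prop) : Prop :=
  [/\ S 0, forall x y, S x -> S y -> S (x + y), forall a x, S x -> S (a * x)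
    & forall a x, S x -> S (x * a)].

Lemma ideal_prop_left S : ideal_prop S ->
  submod_closed ((fun x => `[< S x >]) : {pred R^o}).
Proof.
case=> S0 SD Sl Sr; split=> [|a u v /asboolP Su /asboolP Sv]; apply/asboolP => //.
exact/SD/Sv/Sl.
Qed.

Lemma ideal_prop_right S : ideal_prop S ->
  submod_closed ((fun x => `[< S x >]) : {pred (R^c)^o}).
Proof.
case=> S0 SD Sl Sr; split=> [|a u v /asboolP Su /asboolP Sv]; apply/asboolP => //.
exact/SD/Sv/Sr.
Qed.

Definition mkideal S (hS : ideal_prop S) : ideal R :=
  Ideal (ideal_prop_left hS) (ideal_prop_right hS).

Lemma mkidealP S (hS : ideal_prop S) x : reflect (S x) (x \in mkideal hS).
Proof. exact: asboolP. Qed.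

Lemma ideal_right_prop I : submodule_prop (fun x : (R^c)^o => (x : R) \in I).
Proof.
split=> [|a u v Iu Iv]; first exact: ideal0.
by apply: idealD => //; apply: idealMr.
Qed.

Definition right_of_ideal I : right_ideal R := mksub (ideal_right_prop I).

Lemma right_of_idealP I (x : R) : reflect (x \in I) ((x : (R^c)^o) \in right_of_ideal I).
Proof. exact: mksubP. Qed.

Lemma ideal_nonzero I : ~ ideal_zero I -> exists2 x, x \in I & x != 0.
Proof.
move=> I0; apply: contrapT => Hno; apply: I0 => x Ix.
by apply: contrapT => /eqP x0; apply: Hno; exists x.
Qed.

Lemma nonzero_ideal I x : x \in I -> x != 0 -> ~ ideal_zero I.
Proof. by move=> Ix /eqP x0 I0; apply/x0/I0. Qed.

Lemma sum_ideal_prop I J : ideal_prop (fun x => exists2 y, y \in I & x - y \in J).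
Proof.
split.
- by exists 0; rewrite ?subr0 ideal0.
- move=> x y [u Iu Ju] [v Iv Jv]; exists (u + v); first exact: idealD.
  by rewrite opprD addrACA idealD.
- by move=> a x [u Iu Ju]; exists (a * u); rewrite ?idealMl // -mulrBr idealMl.
- by move=> a x [u Iu Ju]; exists (u * a); rewrite ?idealMr // -mulrBl idealMr.
Qed.

Definition sum_ideal I J : ideal R := mkideal (sum_ideal_prop I J).

Lemma residual_ideal_prop I P :
  ideal_prop (fun r => forall p, p \in P -> r * p \in I).
Proof.
split.
- by move=> p _; rewrite mul0r ideal0.
- by move=> x y Hx Hy p Pp; rewrite mulrDl idealD ?Hx ?Hy.
- by move=> a x Hx p Pp; rewrite -mulrA idealMl ?Hx.
- by move=> a x Hx p Pp; rewrite -mulrA Hx ?idealMl.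
Qed.

(** For an invertible [P] containing [I] this is [I P^-1]. *)
Definition residual_ideal I P : ideal R := mkideal (residual_ideal_prop I P).

Lemma ideal_max (F : ideal R -> Prop) I0 : left_noetherian R^c -> F I0 ->
  exists I, F I /\ forall J, F J -> {subset I <= J} -> {subset J <= I}.
Proof.
move=> nR F0.
pose G (N : right_ideal R) := exists2 I, F I & forall x : R, ((x : (R^c)^o) \in N) = (x \in I).
have [|//|N [[I FI NI] Nmax]] :=
  acc_max (F := G) (N0 := right_of_ideal I0) (iffLR noetherian_acc nR).
  by exists I0 => // x; apply/right_of_idealP/idP.
exists I; split=> // J FJ IJ x Jx; rewrite -NI.
apply: (Nmax (right_of_ideal J)); last exact/right_of_idealP.
  by exists J => // y; apply/right_of_idealP/idP.
by move=> y; rewrite NI => /IJ Jy; apply/right_of_idealP.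
Qed.

End Ideals.

(** * Essential right ideals of prime rings *)

Section PrimeRing.
Context {R : nzRingType}.
Hypothesis prR : prime_ring R.

(** If [a R b = 0], the ideals [J = {x | a R x = 0}] and [{y | y J = 0}] contain
    [b] and [a], and the product of the second with [J] is zero. *)
Lemma prime_elt (a b : R) : a != 0 -> b != 0 -> exists r, a * r * b != 0.
Proof.
move=> a0 b0; apply: contrapT => Hno.
have ab r : a * r * b = 0 by apply: contrapT => /eqP H; apply: Hno; exists r.
have hJ : ideal_prop (fun x => forall r, a * r * x = 0).
  split=> [r|x y Hx Hy r|c x Hx r|c x Hx r]; first by rewrite mulr0.
  - by rewrite mulrDr Hx Hy addr0.
  - by rewrite mulrA -(mulrA a) Hx.
  - by rewrite mulrA Hx mul0r.
pose J := mkideal hJ.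
have hI : ideal_prop (fun y => forall x, x \in J -> y * x = 0).
  split=> [r|x y Hx Hy r Jr|c x Hx r Jr|c x Hx r Jr]; first by rewrite mul0r.
  - by rewrite mulrDl Hx ?Hy ?addr0.
  - by rewrite -mulrA Hx ?mulr0.
  - by rewrite -mulrA Hx // idealMl.
pose I := mkideal hI.
have [|I0|J0] := prR (I := I) (J := J).
- move=> _ [n [x [y [Ix Jy ->]]]]; apply: big1 => i _.
  have /mkidealP H : x i \in I := Ix i; exact: (H _ (Jy i)).
- have Ia : a \in I by apply/mkidealP => x /mkidealP/(_ 1); rewrite mulr1.
  by rewrite (I0 a Ia) eqxx in a0.
- have Jb : b \in J by apply/mkidealP.
  by rewrite (J0 b Jb) eqxx in b0.
Qed.

End PrimeRing.

Section EssentialRightIdeals.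
Context {R : nzRingType}.
Hypothesis hR : left_hereditary R^c.
Hypothesis nlR : left_noetherian R.
Hypothesis nrR : left_noetherian R^c.

Let nsR := hereditary_nonsingular hR nrR.

Lemma row_noetherian k : noetherian 'rV[R]_k.
Proof.
apply: finitely_generated_noetherian => //.
by exists k, (delta_mx 0) => v; exists (v 0); rewrite -row_sum_delta.
Qed.

(** The module [(u R + E) / E] is simple, a weak form of Webber's theorem that
    [R / E] has finite length. The dual [Hom(E', R)] of a right ideal [E']
    containing [E] embeds, by evaluation at finitely many generators of [E], into
    a noetherian left module; it shrinks as [E'] grows, and determines [E']
    because [E'] is projective. So an [E'] strictly containing [E] with maximal
    dual is minimal over [E]. *)
Lemma essential_cover (E : right_ideal R) :
  ess (fun x : R^c => x \in E) -> (1 : R) \notin E ->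
  exists u : R, u \notin E /\
    forall s : R, u * s \notin E -> exists t : R, u - u * s * t \in E.
Proof.
move=> esE E1.
have [s Hs] := acc_on_fg (N := E) (iffLR noetherian_acc nrR) (fun _ _ => Logic.I).
pose Lam (E' : right_ideal R) (l : 'rV[R]_(size s)) :=
  exists2 f : (R^c)^o -> (R^c)^o, lin_on E' f & forall i : 'I_(size s), l 0 i = f s`_i.
have Lam_sub E' : submodule_prop (Lam E').
  split=> [|a l m [f fl fE] [g gl gE]].
    by exists (fun=> 0) => [c u v _ _|i]; rewrite ?scaler0 ?addr0 ?mxE.
  exists (fun x => (a * (f x : R) + g x : R)) => [c u v Eu Ev|i].
    rewrite fl // gl // /GRing.scale /=.
    by rewrite mulrDr addrACA mulrA -mulrDl.
  by rewrite !mxE fE gE.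
pose F (L : submodClosed 'rV[R]_(size s)) := exists2 E' : right_ideal R,
  {subset E <= E'} /\ ~ {subset E' <= E} & L = mksub (Lam_sub E').
have accL : acc_on (fun _ : 'rV[R]_(size s) => True).
  by apply/noetherian_acc/row_noetherian.
have [||_ [[E' [EE' E'E] ->] Lmax]] :=
  acc_max (F := F) (N0 := mksub (Lam_sub full_sub)) accL.
- exists full_sub => //; split=> [x _|H]; first exact: in_full.
  by case/negP: E1; apply: H; apply: in_full.
- by [].
have [u [E'u Eu]] : exists u : R,
    (u : (R^c)^o) \in E' /\ (u : (R^c)^o) \notin E.
  apply: contrapT => Hno; apply: E'E => u E'u; apply: contrapT => /negP Eu.
  by apply: Hno; exists u.
exists u; split=> // r Eur.
pose E2 := sum_sub E (cyc_sub (u * r : (R^c)^o)).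
have E2E' : {subset E2 <= E'}.
  move=> v /sum_subP[e Ee /cyc_subP[c Hc]]; rewrite -(subrK e v) Hc.
  by apply: rpredD (EE' _ Ee); apply/rpredZ/right_idealM.
have E2u : (u * r : (R^c)^o) \in E2 by apply: sum_subr; exact: cyc_sub_self.
have [n [x [f [xE2 fl vE]]]] := dual_basis E2 hR nrR.
have sE (i : 'I_(size s)) : s`_i \in E by rewrite Hs mem_gen // mem_nth.
have /choice[g gP] (j : 'I_n) : exists g : (R^c)^o -> (R^c)^o,
    lin_on E' g /\ forall i : 'I_(size s), f j s`_i = g s`_i.
  have /(mksubP (Lam_sub E'))[g gl gE] : \row_i f j s`_i \in mksub (Lam_sub E').
    apply: (Lmax (mksub (Lam_sub E2))).
    - exists E2 => //; split=> [v Ev|H]; first exact: sum_subl.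
      by case/negP: Eur; apply: H.
    - move=> l /mksubP[h hl hE]; apply/mksubP; exists h => // c v w Ev Ew.
      by apply: hl; apply: E2E'.
    - by apply/mksubP; exists (f j) => // i; rewrite mxE.
  by exists g; split=> // i; rewrite -gE mxE.
(* the dual basis of E2, extended to E', still expresses the elements of E' *)
pose h (e : (R^c)^o) : (R^c)^o := e - \sum_(j < n) (g j e : R^c) * x j.
have hl : lin_on E' h.
  move=> c v w Ev Ew; rewrite /h scalerBr addrACA -opprD; congr (_ - _).
  rewrite scaler_sumr -big_split; apply: eq_bigr => j _ /=.
  by have [-> //] := gP j; rewrite mulrDl /GRing.scale /= mulrA.
have hE v : v \in E -> h v = 0.
  rewrite Hs => /gen_sum[c ->]; rewrite (lin_on_sum hl) => [|i _].
    apply: big1 => i _; rewrite (lin_onZ hl) //; last exact: EE'.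
    suff -> : h s`_i = 0 by rewrite scaler0.
    apply/eqP; rewrite subr_eq0; apply/eqP.
    rewrite {1}(vE s`_i) ?sum_subl //; apply: eq_bigr => j _.
    by have [_ ->] := gP j.
  by rewrite rpredZ // EE'.
have hu : h u = 0.
  apply: (nonsing_eq0 nsR (ess_transporter (E := E) u esE)) => a Ea.
  by rewrite -[LHS]/(a *: h u) -(lin_onZ hl) // hE.
have /sum_subP[e Ee /cyc_subP[t Ht]] : (u : (R^c)^o) \in E2.
  move/eqP: hu; rewrite subr_eq0 => /eqP ->; apply: rpred_sum => j _.
  by rewrite -[_ * _]/((g j u : R^c) *: (x j : (R^c)^o)) rpredZ.
exists t; have -> : u - u * r * t = e; last by [].
by rewrite -[u * r * t]/((t : R^c) *: (u * r : (R^c)^o)) -Ht opprB addrC subrK.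
Qed.

Hypothesis prR : prime_ring R.
Hypothesis npR : ~ left_primitive R^c.

(** In a maximal counterexample [E], a simple submodule [E' / E] of [R / E] is
    killed by some nonzero [a] since [R] is not primitive; by maximality [E']
    contains [R r] for some nonzero [r], and then [E] contains [R r t a] for
    all [t]. Since [E] is a right ideal, it contains the two-sided ideal
    generated by such an element. *)
Lemma essential_bounded (E : right_ideal R) :
  ess (fun x : R^c => x \in E) -> exists2 r : R, r != 0 & forall a : R, a * r \in E.
Proof.
move=> esE; apply: contrapT => ubE.
pose F (N : right_ideal R) := ess (fun x : R^c => x \in N) /\
  ~ exists2 r : R, r != 0 & forall a : R, a * r \in N.
have [//|//|{}E [[{}esE {}ubE] Emax]] := acc_max (F := F) (N0 := E) (iffLR noetherian_acc nrR).
have E1 : (1 : R) \notin E.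
  apply/negP => E1; apply: ubE; exists 1; first exact: oner_neq0.
  by move=> a; rewrite mulr1 -[a]mul1r; exact: right_idealM.
have [u [Eu uP]] := essential_cover esE E1.
have hB : submodule_prop (fun x : (R^c)^o => (u * (x : R) : (R^c)^o) \in E).
  split=> [|a x y Ex Ey]; first by rewrite mulr0 rpred0.
  by rewrite mulrDr rpredD // mulrA; apply: right_idealM.
pose B : right_ideal R := mksub hB.
have [a a0 Ea] : exists2 a : R, a != 0 & forall t : R, (u * t * a : (R^c)^o) \in E.
  apply: contrapT => Hno; apply: npR; exists (quotmod B); split; last first.
    move=> a Ha; apply: contrapT => /eqP a0; apply: Hno; exists a => // t.
    have := Ha (\pi_(quotmod B) (t : (R^c)^o)).
    by rewrite -linearZZ => /quot_pi0/mksubP; rewrite /GRing.scale /= mulrA.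
  split=> [|N].
    exists (\pi_(quotmod B) 1); apply/eqP => /quot_pi0/mksubP.
    by rewrite mulr1; apply/negP.
  have [Nall|Hno1] := pselect (forall v, v \in N -> v = 0); [by left|right=> v].
  have [w [Nw w0]] : exists w, w \in N /\ w <> 0.
    apply: contrapT => H; apply: Hno1 => w Nw; apply: contrapT => w0; apply: H.
    by exists w.
  have [x wE] : exists x : R, w = \pi_(quotmod B) (x : (R^c)^o).
    by have [x ->] := quot_piW w; exists x.
  rewrite {w}wE in Nw w0.
  have [|t Ht] := uP x; first by apply/negP => Hx; apply/w0/quot_pi0/mksubP.
  have [y ->] : exists y : R, v = \pi_(quotmod B) (y : (R^c)^o).
    by have [y ->] := quot_piW v; exists y.
  have -> : \pi_(quotmod B) (y : (R^c)^o) =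
      (t * y : R^c) *: \pi_(quotmod B) (x : (R^c)^o).
    rewrite -linearZZ; apply/quot_pi_eq/(mksubP hB).
    have yE : (u - u * x * t) * y = u * (y - x * (t * y)).
      by rewrite mulrBr mulrBl !mulrA.
    by have := right_idealM y Ht; rewrite yE.
  by rewrite rpredZ.
pose E' := sum_sub E (cyc_sub (u : (R^c)^o)).
have E'u : u \in E' by apply/sum_subr/cyc_sub_self.
have [r r0 Er] : exists2 r : R, r != 0 & forall a : R, a * r \in E'.
  apply: contrapT => ubE'; case/negP: Eu; apply: (Emax E') => //.
    by split=> //; apply: (ess_sub esE) => x; apply: sum_subl.
  by move=> x; apply: sum_subl.
have [t rta] := prime_elt prR r0 a0; apply: ubE; exists (r * t * a) => // c.
have /sum_subP[e Ee /cyc_subP[b Hb]] := Er c.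
have crE : c * r = (e : R) + u * b.
  apply/eqP; rewrite addrC -subr_eq; apply/eqP; exact: Hb.
have -> : c * (r * t * a) = (e : R) * (t * a) + u * ((b : R) * t) * a.
  by rewrite !mulrA crE !mulrDl.
apply: rpredD; [exact: right_idealM | exact: Ea].
Qed.

End EssentialRightIdeals.

(** * Invertible ideals *)

(** The product [Y C]. With this impredicative form, membership is exploited by
    exhibiting a submodule rather than by handling finite sums. *)
Definition mul_ideal_prop {R : nzRingType} {V : lmodType R^c}
    (Y : submodClosed V) (C : ideal R) (v : V) : Prop :=
  forall N : submodClosed V,
    (forall y c, y \in Y -> c \in C -> y <* c \in N) -> v \in N.

Lemma mul_ideal_submodule {R : nzRingType} {V : lmodType R^c}
  (Y : submodClosed V) (C : ideal R) : submodule_prop (mul_ideal_prop Y C).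
Proof.
split=> [N _|a u v Hu Hv N HN]; first exact: rpred0.
by apply: submod_comb; [apply: Hu | apply: Hv].
Qed.

Definition mul_ideal {R : nzRingType} {V : lmodType R^c}
  (Y : submodClosed V) (C : ideal R) : submodClosed V :=
  mksub (mul_ideal_submodule Y C).

Section MulIdeal.
Context {R : nzRingType} {V : lmodType R^c}.
Implicit Types (Y N : submodClosed V) (C : ideal R).

Lemma mem_mul_ideal Y C y c : y \in Y -> c \in C -> y <* c \in mul_ideal Y C.
Proof. by move=> Yy Cc; apply/mksubP => N; apply. Qed.

Lemma mul_ideal_least Y C N :
  (forall y c, y \in Y -> c \in C -> y <* c \in N) -> {subset mul_ideal Y C <= N}.
Proof. by move=> H v /mksubP; apply. Qed.

Lemma mul_ideal_mono Y Y' C :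
  {subset Y <= Y'} -> {subset mul_ideal Y C <= mul_ideal Y' C}.
Proof. by move=> YY'; apply: mul_ideal_least => y c /YY'; apply: mem_mul_ideal. Qed.

Lemma mul_ideal_sub Y C : {subset mul_ideal Y C <= Y}.
Proof. by apply: mul_ideal_least => y c Yy _; apply: submod_ract. Qed.

End MulIdeal.

Section Invertible.
Context {R : nzRingType} {Q : unitRingType} (iota : {rmorphism R -> Q}).
Hypothesis iota_inj : injective iota.
Implicit Types (I P C : ideal R).

(** The inverse [J] is used only through its products with elements of [I], which
    lie in [R]. *)
Lemma invertible_inverse I : invertible_ideal iota I ->
  exists J : Q -> Prop,
    [/\ forall b y, J b -> y \in I -> exists r, iota r = b * iota y,
        forall b y, J b -> y \in I -> exists r, iota r = iota y * b,
        exists n (x : 'I_n -> R) (b : 'I_n -> Q), [/\ forall i, x i \in I,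
          forall i, J (b i) & \sum_(i < n) iota (x i) * b i = 1]
      & exists n (b : 'I_n -> Q) (x : 'I_n -> R), [/\ forall i, J (b i),
          forall i, x i \in I & \sum_(i < n) b i * iota (x i) = 1]].
Proof.
move=> [J [bJ IJ JI]]; exists J; split=> [b y Jb Iy|b y Jb Iy||].
- suff [r _ <-] : range iota (b * iota y) by exists r.
  rewrite -JI; exists 1%N, (fun=> b), (fun=> iota y).
  by split=> [_|_|]; [exact: Jb | exists y | rewrite big_ord1].
- suff [r _ <-] : range iota (iota y * b) by exists r.
  rewrite -IJ; exists 1%N, (fun=> iota y), (fun=> b).
  by split=> [_|_|]; [exists y | exact: Jb | rewrite big_ord1].
- have : range iota 1 by exists 1; rewrite ?rmorph1.
  rewrite -IJ => -[n [x' [b [Ix Jb E]]]].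
  have /choice[x Hx] i : exists x, x \in I /\ x' i = iota x.
    by have [x Hx <-] := Ix i; exists x.
  exists n, x, b; split=> // [i|]; first by case: (Hx i).
  by rewrite E; apply: eq_bigr => i _; case: (Hx i) => _ ->.
- have : range iota 1 by exists 1; rewrite ?rmorph1.
  rewrite -JI => -[n [b [x' [Jb Ix E]]]].
  have /choice[x Hx] i : exists x, x \in I /\ x' i = iota x.
    by have [x Hx <-] := Ix i; exists x.
  exists n, b, x; split=> // [i|]; first by case: (Hx i).
  by rewrite E; apply: eq_bigr => i _; case: (Hx i) => _ ->.
Qed.

Lemma invertible_faithful C z : invertible_ideal iota C ->
  (forall c, c \in C -> z * c = 0) -> z = 0.
Proof.
move=> /invertible_inverse[J [_ _ [n [x [b [Cx _ E]]]] _]] zC; apply: iota_inj.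
rewrite rmorph0 -[iota z]mulr1 -E mulr_sumr big1 // => i _.
by rewrite mulrA -rmorphM zC // rmorph0 mul0r.
Qed.

Lemma invertible_nonzero C : invertible_ideal iota C -> ~ ideal_zero C.
Proof.
move=> invC C0; case/negP: (oner_neq0 R); apply/eqP.
by apply: (invertible_faithful invC) => c /C0 ->; rewrite mulr0.
Qed.

(** If [E] contains an invertible ideal [C], then [Hom(E, R)] lies in the inverse
    of [C], so [C Hom(E, R)] consists of left multiplications by elements of
    [R]. *)
Lemma mul_hom_inner C (E : right_ideal R) (f : (R^c)^o -> (R^c)^o) (c : R) :
  invertible_ideal iota C -> (forall x : R, x \in C -> (x : (R^c)^o) \in E) ->
  lin_on E f -> c \in C ->
  exists r : R, forall e : R, (e : (R^c)^o) \in E -> c * f e = r * e.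
Proof.
move=> invC CE fl Cc.
have [J [JC CJ [n [x [b [Cx Jb E1]]]] _]] := invertible_inverse invC.
have fr (e a : R) : (e : (R^c)^o) \in E -> (f (e * a : R) : R) = (f e : R) * a.
  by move=> Ee; apply: (lin_onZ fl (a : R^c) Ee).
have /choice[d dE] i : exists r, iota r = iota (c * (f (x i) : R)) * b i.
  by apply: CJ => //; apply: idealMr.
have CfE (y : R) : y \in C -> c * (f y : R) = (\sum_(i < n) d i) * y.
  move=> Cy; have /choice[a aE] i := JC _ _ (Jb i) Cy.
  have yE : y = \sum_(i < n) x i * a i.
    apply: iota_inj; rewrite rmorph_sum -[LHS]mul1r -E1 mulr_suml.
    by apply: eq_bigr => i _; rewrite rmorphM aE mulrA.
  rewrite {1}yE (lin_on_sum fl) => [|i _]; last exact/right_idealM/CE.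
  rewrite mulr_sumr mulr_suml; apply: eq_bigr => i _; apply: iota_inj.
  by rewrite fr ?CE // mulrA !rmorphM dE aE !rmorphM !mulrA.
exists (\sum_(i < n) d i) => e Ee; apply/eqP; rewrite -subr_eq0; apply/eqP.
apply: (invertible_faithful invC) => y Cy.
by rewrite mulrBl -!mulrA -fr // CfE ?subrr // idealMl.
Qed.

(** Expand [e] in [E] as [sum x_i f_i(e)] in a dual basis. Each [f (x_i)] is a sum
    of products [y c] with [c] in [C], and [c f_i] is a left multiplication by an
    element of [R]. *)
Lemma hom_inner (V : lmodType R^c) C (E : right_ideal R) (Y : submodClosed V)
    (f : (R^c)^o -> V) :
  left_hereditary R^c -> left_noetherian R^c ->
  invertible_ideal iota C -> (forall x : R, x \in C -> (x : (R^c)^o) \in E) ->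
  lin_on E f -> (forall e, e \in E -> f e \in mul_ideal Y C) ->
  exists2 y, y \in Y & forall e : R, (e : (R^c)^o) \in E -> f e = y <* e.
Proof.
move=> hR nR invC CE fl fYC.
pose T (v : V) := forall g : (R^c)^o -> (R^c)^o, lin_on E g ->
  exists2 y, y \in Y & forall e : R, (e : (R^c)^o) \in E -> v <* g e = y <* e.
have T_sub : submodule_prop T.
  split=> [g _|a u v Tu Tv g gl].
    by exists 0; rewrite ?rpred0 // => e _; rewrite !ract0r.
  pose ag (x : (R^c)^o) : (R^c)^o := (a : R) * (g x : R).
  have agl : lin_on E ag.
    move=> b x y Ex Ey; rewrite /ag gl // /GRing.scale /=.
    by rewrite mulrDr mulrA.
  have [y Yy Hy] := Tu _ agl; have [z Yz Hz] := Tv _ gl.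
  exists (y + z); first exact: rpredD.
  by move=> e Ee; rewrite !ractDl -Hy // -Hz // -[a *: u]/(u <* a) ractA.
have YCT : {subset mul_ideal Y C <= mksub T_sub}.
  apply: mul_ideal_least => y c Yy Cc; apply/mksubP => g gl.
  have [r Hr] := mul_hom_inner invC CE gl Cc.
  by exists (y <* r); [exact: submod_ract | move=> e Ee; rewrite !ractA Hr].
have [n [x [g [xE gl eE]]]] := dual_basis E hR nR.
have /choice[y Hy] i : exists y, y \in Y /\
    forall e : R, (e : (R^c)^o) \in E -> f (x i) <* g i e = y <* e.
  have /mksubP/(_ _ (gl i))[y Yy Hy] := YCT _ (fYC _ (xE i)).
  by exists y.
exists (\sum_(i < n) y i); first by apply: rpred_sum => i _; case: (Hy i).
move=> e Ee; rewrite {1}(eE _ Ee) (lin_on_sum fl) => [|i _]; last first.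
  exact: (rpredZ (g i e : R^c) (xE i)).
rewrite ract_suml; apply: eq_bigr => i _; have [_ <- //] := Hy i.
exact: (lin_onZ fl (g i e : R^c) (xE i)).
Qed.

(** The map [c |-> v c] from [C] to [Y C] is the action of some [y] in [Y]. *)
Lemma mul_ideal_cancel (V : lmodType R^c) C (Y : submodClosed V) v :
  left_hereditary R^c -> left_noetherian R^c -> invertible_ideal iota C ->
  (forall c, c \in C -> v <* c \in mul_ideal Y C) ->
  exists2 y, y \in Y & forall c, c \in C -> (v - y) <* c = 0.
Proof.
move=> hR nR invC vC.
have [|||y Yy Hy] := @hom_inner V C (right_of_ideal C) Y (fun c => v <* c) hR nR invC.
- by move=> x Cx; apply/right_of_idealP.
- by move=> a x z _ _; rewrite ractDr -ractA.
- by move=> e /right_of_idealP; apply: vC.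
exists y => // c Cc; rewrite ractBl Hy ?subrr //; exact/right_of_idealP.
Qed.

(** Otherwise [I P^-1 = I], so [I = I P], and cancelling [I] gives [P = R]. *)
Lemma residual_ideal_proper I P :
  invertible_ideal iota I -> invertible_ideal iota P -> 1 \notin P ->
  {subset I <= P} -> exists2 r, r \in residual_ideal I P & r \notin I.
Proof.
move=> invI invP P1 IP; apply: contrapT => Hno.
have {}Hno r : r \in residual_ideal I P -> r \in I.
  by move=> Hr; apply: contrapT => /negP Ir; apply: Hno; exists r.
have [JP [JPP PJP _ [n [b [a [Jb Pa E]]]]]] := invertible_inverse invP.
have [JI [JII _ _ [m [b' [x [Jb' Ix E']]]]]] := invertible_inverse invI.
have Iexp y : y \in I -> exists2 z : 'I_n -> R, (forall i, z i \in I) &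
    y = \sum_(i < n) z i * a i.
  move=> Iy; have /choice[z zE] i := PJP _ _ (Jb i) (IP _ Iy).
  exists z => [i|].
    apply: Hno; apply/mkidealP => p Pp; have [d dE] := JPP _ _ (Jb i) Pp.
    suff -> : z i * p = y * d by apply: idealMr.
    by apply: iota_inj; rewrite !rmorphM zE dE mulrA.
  apply: iota_inj; rewrite rmorph_sum -[LHS]mulr1 -E mulr_sumr.
  by apply: eq_bigr => i _; rewrite rmorphM zE mulrA.
case/negP: P1.
have Pj j : exists2 p, p \in P & iota p = b' j * iota (x j).
  have [z Iz ->] := Iexp _ (Ix j).
  have /choice[d dE] i := JII _ _ (Jb' j) (Iz i).
  exists (\sum_(i < n) d i * a i).
    apply: (big_ind (fun p => p \in P)) => [|u v|i _]; [exact: ideal0|exact: idealD|].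
    exact: idealMl.
  rewrite !rmorph_sum mulr_sumr; apply: eq_bigr => i _.
  by rewrite !rmorphM dE mulrA.
have -> : (1 : R) = \sum_(j < m) s2val (cid2 (Pj j)).
  apply: iota_inj; rewrite rmorph1 -E' rmorph_sum; apply: eq_bigr => j _.
  by rewrite (s2valP' (cid2 (Pj j))).
apply: (big_ind (fun p => p \in P)) => [|u v|j _]; [exact: ideal0|exact: idealD|].
exact: (s2valP (cid2 (Pj j))).
Qed.

Section MaximalInvertible.
Hypothesis dedR : forall I : ideal R, ~ ideal_zero I -> invertible_ideal iota I.

Lemma maximal_invertible_invertible P :
  maximal_invertible iota P -> invertible_ideal iota P.
Proof. by case=> -[]. Qed.

Lemma maximal_invertible_comaximal I P : maximal_invertible iota P ->
  ~ {subset I <= P} -> exists2 j, j \in I & 1 - j \in P.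
Proof.
move=> [[P1 invP] Pmax] IP; apply: contrapT => Hno; apply: IP => x Ix.
have PS : {subset P <= sum_ideal I P}.
  by move=> p Pp; apply/mkidealP; exists 0; rewrite ?ideal0 // subr0.
suff <- : sum_ideal I P =i P.
  by apply/mkidealP; exists x; rewrite // subrr ideal0.
apply: Pmax => //; split; first by apply/negP => /mkidealP[j Ij Pj]; apply: Hno; exists j.
have [p Pp p0] := ideal_nonzero (invertible_nonzero invP).
exact/dedR/(nonzero_ideal (PS _ Pp)).
Qed.

Lemma maximal_invertible_exists I : left_noetherian R^c -> ~ ideal_zero I ->
  1 \notin I -> exists2 P, maximal_invertible iota P & {subset I <= P}.
Proof.
move=> nR I0 I1; have [x Ix x0] := ideal_nonzero I0.
have [|P [[P1 IP] Pmax]] :=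
  ideal_max (F := fun J => 1 \notin J /\ {subset I <= J}) (I0 := I) nR.
  by split.
exists P => //; split.
  by split=> //; apply/dedR/(nonzero_ideal (IP _ Ix)).
move=> J [J1 _] PJ y; apply/idP/idP; last exact: PJ.
by apply: Pmax => //; split=> // z /IP/PJ.
Qed.

(** The relation [x P^m <= S], with the factors of the power taken one at a time
    so as to allow induction on [m]. *)
Fixpoint mul_pow_in (S : R -> Prop) P (m : nat) (x : R) : Prop :=
  if m is k.+1 then forall p, p \in P -> mul_pow_in S P k (x * p) else S x.

(** By noetherian induction: if [I] is not comaximal to [P], it is contained in [P]
    and one passes to the larger ideal [I P^-1]. *)
Lemma ideal_factor I P : left_noetherian R^c -> ~ ideal_zero I ->
  maximal_invertible iota P ->
  exists m j, 1 - j \in P /\ mul_pow_in (fun x => x \in I) P m j.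
Proof.
move=> nR I0 mP; apply: contrapT => Hno.
pose F J := ~ ideal_zero J /\
  ~ exists m j, 1 - j \in P /\ mul_pow_in (fun x => x \in J) P m j.
have [//|{}I [[{}I0 {}Hno] Imax]] := ideal_max (F := F) (I0 := I) nR.
have IP : {subset I <= P}.
  apply: contrapT => /(maximal_invertible_comaximal mP)[j Ij Pj].
  by apply: Hno; exists 0%N, j.
have IR : {subset I <= residual_ideal I P}.
  by move=> x Ix; apply/mkidealP => p _; apply: idealMr.
have [[P1 invP] _] := mP.
have [r Ir /negP] := residual_ideal_proper (dedR I0) invP P1 IP; apply.
apply: Imax Ir => //; split=> [R0|[m [j [Pj jm]]]].
  by apply: I0 => x /IR/R0.
apply: Hno; exists m.+1, j; split=> //.
elim: m j {Pj} jm => [|m IH] x /=; last by move=> Hx p /Hx/IH.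
by move=> /(mkidealP (residual_ideal_prop I P)) H; exact: H.
Qed.

End MaximalInvertible.

End Invertible.

(** * Primary modules *)

Section Killed.
Context {R : nzRingType} (P : ideal R).

(** The relation [x P^n = 0], with the factors of the power taken one at a time. *)
Fixpoint killed {V : lmodType R^c} (n : nat) (x : V) : Prop :=
  if n is k.+1 then forall p, p \in P -> killed k (x <* p) else x = 0.

Lemma killed_submodule (V : lmodType R^c) n :
  submodule_prop (fun x : V => killed n x).
Proof.
elim: n => [|n [IH0 IH]]; first exact: zero_sub_subproof.
split=> [p Pp|a u v Hu Hv p Pp]; first by rewrite ract0r.
rewrite ractDl -[a *: u]/(u <* a) ractA -[X in X + _]scale1r.
by apply: IH; [apply/Hu/idealMl | apply: Hv].
Qed.

Definition killed_sub (V : lmodType R^c) n : submodClosed V :=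
  mksub (killed_submodule V n).

Lemma killed_subP (V : lmodType R^c) n (x : V) :
  reflect (killed n x) (x \in killed_sub V n).
Proof. exact: mksubP. Qed.

Lemma killedS (V : lmodType R^c) n (x : V) : killed n x -> killed n.+1 x.
Proof.
elim: n x => [|n IH] x; first by move=> -> p _; rewrite /= ract0r.
by move=> Hx p Pp; apply/IH/Hx.
Qed.

Lemma killed_linear (V W : lmodType R^c) (f : {linear V -> W}) n x :
  killed n x -> killed n (f x).
Proof.
elim: n x => [|n IH] x /=; first by move->; rewrite linear0.
by move=> Hx p Pp; rewrite -linear_ract; apply/IH/Hx.
Qed.

Lemma killed_inj (V W : lmodType R^c) (f : {linear V -> W}) n x :
  injective f -> killed n (f x) -> killed n x.
Proof.
move=> f_inj; elim: n x => [|n IH] x /=; first by rewrite -(linear0 f) => /f_inj.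
by move=> Hx p Pp; apply: IH; rewrite linear_ract; apply: Hx.
Qed.

Lemma killed_ract (V : lmodType R^c) n (x : V) r : killed n x -> killed n (x <* r).
Proof. by move=> /killed_subP Hx; apply/killed_subP/submod_ract. Qed.

Lemma killed_socle (V : lmodType R^c) n (x : V) :
  killed n x -> x != 0 -> exists r, x <* r != 0 /\ killed 1 (x <* r).
Proof.
elim: n x => [|n IH] x; first by move=> /= ->; rewrite eqxx.
move=> Hx x0; have [H1|/existsNP[p /not_implyP[Pp /eqP xp]]] := pselect (killed 1 x).
  by exists 1; rewrite ract1.
have [r []] := IH _ (Hx p Pp) xp.
by exists (p * r); rewrite -ractA.
Qed.

Definition divisible_module (V : lmodType R^c) : Prop :=
  forall v : V, v \in @mul_ideal R V full_sub P.

Definition primary_module (V : lmodType R^c) : Prop :=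
  forall x : V, exists n, killed n x.

Lemma primary_quot (V : lmodType R^c) (N : submodClosed V) :
  primary_module V -> primary_module (quotmod N).
Proof.
move=> pV x; have [v ->] := quot_piW x; have [n Hn] := pV v.
by exists n; apply: killed_linear.
Qed.

End Killed.

Arguments killed_sub {R} P {V} n.

Section Primary.
Context {R : nzRingType} {Q : unitRingType} (iota : {rmorphism R -> Q}).
Hypothesis iota_inj : injective iota.
Hypothesis hR : left_hereditary R^c.
Hypothesis nlR : left_noetherian R.
Hypothesis nrR : left_noetherian R^c.
Hypothesis dedR : forall I : ideal R, ~ ideal_zero I -> invertible_ideal iota I.
Variable P : ideal R.
Hypothesis mP : maximal_invertible iota P.

Let invP := maximal_invertible_invertible mP.

(** The right module [(u R + P) / P] is then simple. *)
Definition simple_generator (u : R) : Prop :=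
  u \notin P /\ forall s, u * s \notin P -> exists t, u - u * s * t \in P.

Lemma simple_generator_exists : exists u, simple_generator u.
Proof.
have esP : ess (fun x : R^c => (x : (R^c)^o) \in right_of_ideal P).
  move=> x /eqP x0; apply: contrapT => Hno; apply: x0.
  apply: (invertible_faithful iota_inj invP) => p Pp.
  apply: contrapT => /eqP xp; apply: Hno; exists p => //.
  exact/right_of_idealP/idealMl.
have P1 : (1 : R) \notin right_of_ideal P.
  by apply/negP => /right_of_idealP; apply/negP; case: mP => -[].
have [u [Pu uP]] := essential_cover hR nlR nrR esP P1.
exists u; split=> [|s us]; first by apply: contraNN Pu => Pu; apply/right_of_idealP.
have [|t /right_of_idealP Ht] := uP s; last by exists t.
by apply: contraNN us => /right_of_idealP.
Qed.

Variable u : R.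
Hypothesis uP : simple_generator u.

(** Then [w s |-> u s] is an isomorphism from [w R] onto [(u R + P) / P]. *)
Definition simple_elt {V : lmodType R^c} (w : V) : Prop :=
  forall s, w <* s = 0 <-> u * s \in P.

Section Modules.
Context {V : lmodType R^c}.
Implicit Types (N : submodClosed V) (x w : V).

Lemma simple_elt_neq0 w : simple_elt w -> w != 0.
Proof.
move=> Sw; apply/eqP => w0; have [] := Sw 1; rewrite w0 ract0r mulr1 => /(_ erefl) Pu _.
by move: Pu; apply/negP; case: uP.
Qed.

Lemma simple_elt_meet N w s : simple_elt w -> w \notin N -> w <* s \in N -> w <* s = 0.
Proof.
move=> Sw Nw Nws; apply/Sw; apply: contrapT => /negP us.
have [_ /(_ s us)[t Ht]] := uP; case/negP: Nw.
suff -> : w = w <* s <* t by apply: submod_ract.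
apply/eqP; rewrite -subr_eq0 ractA -{1}[w]ract1 -ractBr; apply/eqP/Sw.
by rewrite mulrBr mulr1 mulrA.
Qed.

(** The ideal generated by [u] is comaximal to [P], so [x] lies in the submodule
    generated by the [x r u]. *)
Lemma simple_elt_exists N x : killed P 1 x -> x \notin N ->
  exists r, [/\ x <* r \notin N, simple_elt (x <* r) & killed P 1 (x <* r)].
Proof.
move=> Px Nx.
have hJ : ideal_prop (fun z => forall r, x <* (r * z) \in N).
  split=> [r|y z Hy Hz r|a z Hz r|a z Hz r].
  - by rewrite mulr0 ractr0 rpred0.
  - by rewrite mulrDr ractDr rpredD ?Hy ?Hz.
  - by rewrite mulrA; apply: Hz.
  - by rewrite mulrA -ractA; apply/submod_ract/Hz.
have [r Nr] : exists r, x <* (r * u) \notin N.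
  apply: contrapT => Hno.
  have Ju : u \in mkideal hJ.
    apply/mkidealP => r; apply: contrapT => /negP Nr; apply: Hno; by exists r.
  have [|j /mkidealP/(_ 1) Jj Pj] := @maximal_invertible_comaximal _ _ _ iota_inj dedR (mkideal hJ) P mP.
    by move=> /(_ u Ju); apply/negP; case: uP.
  case/negP: Nx; rewrite -[x]ract1 -(subrK j 1) ractDr (Px _ Pj) add0r.
  by rewrite mul1r in Jj.
exists (r * u); split=> //; last exact: killed_ract.
move=> s; rewrite ractA -mulrA; split=> [ws|us]; last by apply: Px; apply: idealMl.
apply: contrapT => /negP us; case/negP: Nr.
have [_ /(_ s us)[t Ht]] := uP.
suff -> : x <* (r * u) = 0 by rewrite rpred0.
rewrite -(subrK (u * s * t) u) mulrDr ractDr (Px _ (idealMl _ Ht)) add0r.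
by rewrite [r * _]mulrA -ractA ws ract0r.
Qed.

End Modules.

(** A maximal extension of [b r |-> d r], given by Zorn's lemma on graphs, is
    defined on all of [B]. For if it is defined on [v P], then [r |-> f (v r)] is a
    homomorphism on a right ideal containing [P], so by divisibility of [D] it is
    the action of an element of [D], which can serve as the image of [v]. *)
Lemma divisible_extension (B D : lmodType R^c) (b : B) (d : D) :
  primary_module P B -> divisible_module P D ->
  (forall r, b <* r = 0 -> d <* r = 0) ->
  exists f : {linear B -> D}, f b = d.
Proof.
move=> pB divD bd.
pose good (G : B -> D -> Prop) := [/\
  forall a v w x y, G v x -> G w y -> G (a *: v + w) (a *: x + y),
  forall x, G 0 x -> x = 0 & G b d].
pose G0 (v : B) (x : D) := exists a, v = b <* a /\ x = d <* a.
have goodG0 : good G0.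
  split=> [a v w x y [r [-> ->]] [s [-> ->]]|x [r [E ->]]|].
  - by exists (r * a + s); rewrite !scale_ract !ractA -!ractDr.
  - exact/bd.
  - by exists 1; rewrite !ract1.
have good0 G : good G -> G 0 0.
  by case=> GD _ Gbd; have := GD (-1) _ _ _ _ Gbd Gbd; rewrite !scaleN1r !addNr.
have goodZ G a v x : good G -> G v x -> G (a *: v) (a *: x).
  by move=> gG Gv; case: (gG) => GD _ _; have := GD a _ _ _ _ Gv (good0 _ gG); rewrite !addr0.
have G0le G : good G -> forall v x, G0 v x -> G v x.
  by move=> gG v x [a [-> ->]]; apply: goodZ => //; case: gG.
pose T := {G : B -> D -> Prop | good G}.
pose le (G H : T) := `[< forall v x, sval G v x -> sval H v x >].
have [||A Atot|[G gG] Gmax] := @ZL_preorder T (exist good G0 goodG0) le.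
- by move=> G; apply/asboolP.
- by move=> H G K /asboolP GH /asboolP HK; apply/asboolP => v x /GH/HK.
- pose A' (G : T) := A G \/ sval G = G0.
  have A'tot (G H : T) : A' G -> A' H -> le G H \/ le H G.
    move=> [AG|G0E] [AH|H0E]; first exact: Atot.
    + by right; apply/asboolP; rewrite H0E; apply: G0le; exact: (svalP G).
    + by left; apply/asboolP; rewrite G0E; apply: G0le; exact: (svalP H).
    + by left; apply/asboolP; rewrite G0E; apply: G0le; exact: (svalP H).
  pose U v x := exists2 G : T, A' G & sval G v x.
  have gU : good U.
    split=> [a v w x y [G AG Gv] [H AH Hw]|x [G AG Gx]|].
    + have [/asboolP GH|/asboolP HG] := A'tot G H AG AH.
        exists H => //; case: (svalP H) => HD _ _; apply: HD => //; exact: GH.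
      exists G => //; case: (svalP G) => GD _ _; apply: GD => //; exact: HG.
    + by case: (svalP G) => _ G0x _; apply: G0x.
    + by exists (exist good G0 goodG0); [right | case: goodG0].
  by exists (exist good U gU) => G AG; apply/asboolP => v x Gv; exists G => //; left.
have [GD Gx0 Gbd] := gG.
have Gfun v x y : G v x -> G v y -> x = y.
  move=> Gx Gy; have := GD (-1) _ _ _ _ Gx Gy; rewrite !scaleN1r addNr.
  by move/Gx0/eqP; rewrite addr_eq0 eqr_opp => /eqP.
have tot v : exists x, G v x.
  have [n] := pB v; elim: n v => [|n IH] v; first by move=> /= ->; exists 0; apply: good0.
  move=> Pv.
  have E_sub : submodule_prop (fun r : (R^c)^o => exists x, G (v <* (r : R)) x).
    split=> [|a r s [x Gx] [y Gy]]; first by exists 0; rewrite ractr0; apply: good0.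
    by exists (a *: x + y); rewrite ractDr -[v <* (a *: r)]ractA; apply: GD.
  have PE (p : R) : p \in P -> (p : (R^c)^o) \in mksub E_sub.
    by move=> Pp; apply/mksubP/IH/Pv.
  pose f (r : (R^c)^o) : D := if pselect (exists x, G (v <* (r : R)) x) is left H
    then sval (cid H) else 0.
  have fE r : r \in mksub E_sub -> G (v <* (r : R)) (f r).
    by move=> /mksubP Er; rewrite /f; case: pselect => // H; case: (cid H).
  have [||x _ Hx] := @hom_inner _ _ _ iota_inj D P (mksub E_sub) full_sub f hR nrR invP PE.
  + move=> a r s Er Es; apply: (Gfun (v <* ((a *: r + s : (R^c)^o) : R))).
      by apply: fE; apply: submod_comb.
    by rewrite ractDr -[v <* (a *: r)]ractA; apply: GD; apply: fE.
  + by move=> r _; apply: divD.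
  pose G' w y := exists a w' y', [/\ G w' y', w = w' + v <* a & y = y' + x <* a].
  have gG' : good G'.
    split=> [a w z y y' [r [w1 [y1 [Gw1 -> ->]]]] [s [w2 [y2 [Gw2 -> ->]]]]|y|].
    + exists (r * a + s), (a *: w1 + w2), (a *: y1 + y2); split; first exact: GD.
        by rewrite ractDr -ractA scalerDr addrACA.
      by rewrite ractDr -ractA scalerDr addrACA.
    + case=> a [w' [y' [Gw E ->]]].
      have va : v <* a = - w' by apply/eqP; rewrite -addr_eq0 addrC -E.
      have Gva : G (v <* a) (- y') by rewrite va -!scaleN1r; apply: goodZ.
      have Ea : (a : (R^c)^o) \in mksub E_sub by apply/mksubP; exists (- y').
      by rewrite -(Hx _ Ea) (Gfun _ _ _ (fE _ Ea) Gva) subrr.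
    + by exists 0, b, d; rewrite !ractr0 !addr0.
  have GG' : le (exist good G gG) (exist good G' gG').
    by apply/asboolP => w y Gw; exists 0, w, y; rewrite !ractr0 !addr0.
  have /asboolP G'G := Gmax _ GG'; exists x; apply: G'G.
  by exists 1, 0, 0; split; rewrite ?ract1 ?add0r //; apply: good0.
have [f Hf] := linear_of_rel GD Gx0 tot.
by exists f; apply: Gfun (Hf b) Gbd.
Qed.

Section BassianPrimary.
Context {V : lmodType R^c}.
Hypothesis bV : strongly_Bassian V.

Lemma acc_on_socle : acc_on (fun x : V => killed P 1 x).
Proof.
have [|s [_ sP]] := @strongly_Bassian_greedy R^c V
    (fun y => simple_elt y /\ killed P 1 y) (fun a => u * (a : R) \in P) bV.
  by move=> y [Sy _]; split; [apply: simple_elt_neq0 | apply: Sy].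
have gen x : killed P 1 x -> x \in gen_sub s.
  move=> Px; apply: contrapT => /negP sx.
  have [r [sxr Sxr Pxr]] := simple_elt_exists Px sx.
  have [|a [/eqP a0 sa]] := sP (x <* r); first by [].
  by apply: a0; apply: simple_elt_meet sa.
move=> N HN; have [n Hn] := acc_gen s nrR HN.
by exists n => m nm v /gen; apply: Hn.
Qed.

(** Along a properly descending chain inside the socle, simple submodules can be
    chosen that leave the chain one after the other; they are independent. *)
Lemma dcc_on_socle (W : nat -> submodClosed V) :
  (forall k, {subset W k.+1 <= W k}) ->
  exists k, forall j, (k <= j)%N -> forall x, killed P 1 x -> x \in W k -> x \in W j.
Proof.
move=> Wdec; apply: contrapT => Hno.
have Wle i j : (i <= j)%N -> {subset W j <= W i}.
  by move=> /subnK <-; elim: (j - i)%N => //= k IH x /Wdec/IH.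
have step k : exists jw : nat * V, [/\ (k <= jw.1)%N, simple_elt jw.2,
    jw.2 \in W k & jw.2 \notin W jw.1].
  apply: contrapT => Hk; apply: Hno; exists k => j kj x Px Wx.
  apply: contrapT => /negP Wjx; apply: Hk.
  have [r [Wr Sr _]] := simple_elt_exists Px Wjx.
  by exists (j, x <* r); split=> //=; apply: submod_ract.
have [F HF] := choice step.
pose K i := iter i (fun k => (F k).1) 0%N.
pose y i := (F (K i)).2.
have Kle i j : (i <= j)%N -> (K i <= K j)%N.
  move=> /subnK <-; elim: (j - i)%N => //= k IH.
  by apply: leq_trans IH _; case: (HF (K (k + i)%N)).
apply: (@no_independent_sequence R^c V y (fun a => u * (a : R) \in P) bV).
- by apply: simple_elt_neq0; case: (HF (K 0%N)).
- by move=> n a; case: (HF (K n)) => _ Sy _ _; apply: Sy.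
suff indep n m (c : nat -> R^c) : \sum_(i < n) c i *: y (m + i)%N = 0 ->
    forall i, (i < n)%N -> c i *: y (m + i)%N = 0.
  by move=> n c; apply: (indep n 0%N).
elim: n m c => // n IH m c; rewrite big_ord_recl addn0 => H.
have c0 : c 0%N *: y m = 0.
  have [_ Sy _ Wy] := HF (K m).
  apply: (simple_elt_meet Sy Wy); move/eqP: H; rewrite addr_eq0 => /eqP.
  rewrite scale_ract => ->; apply: submodN; apply: rpred_sum => i _; apply: rpredZ.
  have [_ _ Wi _] := HF (K (m + bump 0 i)%N).
  by apply: Wle Wi; apply: (Kle m.+1); rewrite addnS ltnS leq_addr.
move: H; rewrite c0 add0r => H [|i]; first by rewrite addn0.
rewrite ltnS addnS -addSn; apply: (IH m.+1 (fun i => c i.+1)).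
by rewrite -[RHS]H; apply: eq_bigr => j _; rewrite /bump /= addSnnS.
Qed.

(** If [X <= Y] are submodules with [X P = Y P] and the same socle, then [X = Y],
    by [mul_ideal_cancel]; so the chain condition passes from [P^n] to
    [P^(n+1)]. *)
Lemma acc_on_killed n : acc_on (fun x : V => killed P n x).
Proof.
elim: n => [|n IH] N HN.
  by exists 0%N => m _ v /= -> _; rewrite rpred0.
pose Xp i (v : V) := v \in N i /\ killed P n.+1 v.
have X_sub i : submodule_prop (Xp i).
  split=> [|a v w [Nv Kv] [Nw Kw]].
    by split; rewrite ?rpred0 //; case: (killed_submodule P V n.+1).
  split; first exact: submod_comb.
  by case: (killed_submodule P V n.+1) => _; apply.
pose X i := mksub (X_sub i).
have Xup i : {subset X i <= X i.+1}.
  by move=> v /mksubP[Nv Kv]; apply/mksubP; split=> //; apply: HN.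
have XPk i v : v \in mul_ideal (X i) P -> killed P n v.
  move=> Hv; apply/killed_subP; apply: mul_ideal_least Hv => y c /mksubP[_ Ky] Pc.
  exact/killed_subP/Ky.
have [n1 Hn1] := IH (fun i => mul_ideal (X i) P) (fun i => mul_ideal_mono (@Xup i)).
have [n2 Hn2] := acc_on_socle HN.
exists (maxn n1 n2) => m; rewrite geq_max => /andP[n1m n2m] v Kv Nv.
have Xv : v \in X m by apply/mksubP.
have vP c : c \in P -> v <* c \in mul_ideal (X n1) P.
  move=> Pc; have Hvc := mem_mul_ideal Xv Pc.
  by apply: (Hn1 m) => //; apply: XPk Hvc.
have [y /mksubP[Ny _] Hy] := mul_ideal_cancel iota_inj hR nrR invP vP.
rewrite -(subrK y v); apply: rpredD; last exact: (chain_le HN (leq_maxl n1 n2)).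
apply: (chain_le HN (leq_maxr n1 n2)); apply: (Hn2 m) => //.
by apply: submodB => //; apply: (chain_le HN n1m).
Qed.

(** Otherwise let [y R] be a suitable simple submodule and [W] a complement of it
    in the socle. The projection to [V / y R] is injective on [W]; adding to it a
    map that vanishes on [W] and sends [y] to a socle element of [V / y R] outside
    the image of the socle of [V] gives a monomorphism from [V] to [V / y R].
    Such an element exists if [y R] is an image of [P], and [y] is chosen in [x P]
    for some [x] killed by [P^2] but not by [P] to ensure this. *)
Lemma divisible_primary_zero :
  primary_module P V -> divisible_module P V -> forall v : V, v = 0.
Proof.
move=> pV divV v0; apply: contrapT => /eqP v00.
have [x Kx Nx] : exists2 x : V, killed P 2 x & ~ killed P 1 x.
  apply: contrapT => Hno.
  have H12 (x : V) : killed P 2 x -> killed P 1 x.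
    by move=> Kx; apply: contrapT => Nx; apply: Hno; exists x.
  have Hn n (x : V) : killed P n.+1 x -> killed P 1 x.
    by elim: n x => // n IH x Hx; apply: H12 => p Pp; apply/IH/Hx.
  case/negP: v00; apply/eqP.
  have /mksubP : v0 \in zero_sub; last by [].
  apply: (mul_ideal_least _ (divV v0)) => y c _ Pc; apply/mksubP.
  by have [n /killedS/Hn] := pV y; apply.
have [p1 /not_implyP[Pp1 /eqP xp1]] : exists p, ~ (p \in P -> killed P 0 (x <* p)).
  exact/existsNP.
have [||r [_ Sr Kr]] := @simple_elt_exists V zero_sub (x <* p1).
- exact: Kx.
- by apply: contraNN xp1 => /mksubP ->.
pose y := x <* p1 <* r; rewrite -/y in Sr Kr.
have y0 := simple_elt_neq0 Sr.
pose p0 := p1 * r; have Pp0 : p0 \in P by apply: idealMr.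
have yE : y = x <* p0 by rewrite /y ractA.
pose N := cyc_sub y.
have NK v : v \in N -> killed P 1 v.
  by move=> /cyc_subP[a ->]; apply: killed_ract.
pose FW (W : submodClosed V) := (forall v, v \in W -> killed P 1 v) /\
  forall v, v \in W -> v \in N -> v = 0.
have [||W [[WK WN] Wmax]] := @acc_max R^c V _ FW zero_sub acc_on_socle.
- by split=> v /mksubP -> //; case: (killed_submodule P V 1).
- by move=> L [].
have NW t : killed P 1 t -> t \in sum_sub N W.
  move=> Kt; apply: contrapT => /negP NWt.
  have [s [NWs Ss Ks]] := simple_elt_exists Kt NWt.
  case/negP: (NWs); apply: sum_subr.
  apply: (Wmax (sum_sub W (cyc_sub (t <* s)))); last 1 first.
  - exact/sum_subr/cyc_sub_self.
  - split=> [v /sum_subP[w Ww /cyc_subP[a va]]|v /sum_subP[w Ww /cyc_subP[a va]] Nv].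
      rewrite -(subrK w v) va; apply/(killed_subP P 1).
      by apply: rpredD; apply/killed_subP; [apply: killed_ract | apply: WK].
    have a0 : t <* s <* a = 0.
      apply: (simple_elt_meet Ss NWs); rewrite -scale_ract -va.
      by apply: submodB; [apply: sum_subl | apply: sum_subr].
    by move/eqP: va; rewrite scale_ract a0 subr_eq0 => /eqP vw; apply: WN; rewrite // vw.
  - by move=> w Ww; apply: sum_subl.
(* The component in y R of the map p |-> x p extends from P to R, because V is
   divisible; this gives x' outside the socle with x' P inside y R. *)
have /choice[rho0 rhoP] (p : R) : exists n, p \in P -> n \in N /\ x <* p - n \in W.
  have [Pp|Pp] := boolP (p \in P); last by exists 0.
  by have /sum_subP[n Nn Wn] := NW _ (Kx p Pp); exists n.
have uniq_comp v n n' : n \in N -> n' \in N -> v - n \in W -> v - n' \in W -> n = n'.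
  move=> Nn Nn' Wn Wn'; apply/eqP; rewrite -subr_eq0; apply/eqP.
  apply: WN; last exact: submodB.
  have -> : n - n' = (v - n') - (v - n) by rewrite opprB [RHS]addrC addrA subrK.
  exact: submodB.
pose rho (p : (R^c)^o) : V := rho0 (p : R).
have [||| x' _ x'P] := @hom_inner _ _ _ iota_inj V P (right_of_ideal P) full_sub rho hR nrR invP.
- by move=> p Pp; apply/right_of_idealP.
- move=> a p q /right_of_idealP Pp /right_of_idealP Pq.
  have [Np Wp] := rhoP _ Pp; have [Nq Wq] := rhoP _ Pq.
  have Ppq : ((a *: p + q : (R^c)^o) : R) \in P by apply: idealD => //; apply: idealMr.
  have [Npq Wpq] := rhoP _ Ppq.
  apply: uniq_comp Npq _ Wpq _; first exact: submod_comb.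
  have -> : x <* ((a *: p + q : (R^c)^o) : R) - (a *: rho p + rho q) =
      a *: (x <* (p : R) - rho p) + (x <* (q : R) - rho q).
    by rewrite ractDr -[x <* (a *: p)]ractA scalerBr opprD addrACA.
  exact: submod_comb.
- by move=> p _; apply: divV.
have {}x'P p : p \in P -> x' <* p \in N /\ x <* p - x' <* p \in W.
  by move=> Pp; rewrite -(x'P p); [apply: rhoP | apply/right_of_idealP].
have x'p0 : x' <* p0 = y.
  have [Np0 Wp0] := x'P p0 Pp0.
  apply: uniq_comp Np0 (cyc_sub_self y) Wp0 _.
  by rewrite yE subrr rpred0.
pose pi : {linear V -> quotmod N} := \pi_(quotmod N).
pose N2p (t : quotmod N) := exists2 v, killed P 1 v & t = pi v.
have N2_sub : submodule_prop N2p.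
  split=> [|a _ _ [v Kv ->] [w Kw ->]].
    by exists 0; [case: (killed_submodule P V 1) | rewrite linear0].
  exists (a *: v + w); last by rewrite linearP.
  by case: (killed_submodule P V 1) => _; apply.
pose N2 := mksub N2_sub.
have [||s [N2z Sz Kz]] := @simple_elt_exists (quotmod N) N2 (pi x').
- move=> p Pp /=; rewrite -linear_ract; apply/quot_pi0.
  by have [] := x'P p Pp.
- apply/negP => /mksubP[t Kt /quot_pi_eq Nt].
  case/negP: y0; apply/eqP; rewrite -x'p0 -(subrK t x') ractDl.
  by rewrite (Kt _ Pp0) (NK _ Nt _ Pp0) addr0.
pose z := x' <* s; have zE : pi x' <* s = pi z by rewrite -linear_ract.
rewrite zE in N2z Sz Kz.
have [||r0 Hr|del delE] := @divisible_extension (quotmod W) (quotmod N)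
  (\pi_(quotmod W) y) (pi z).
- exact: primary_quot.
- move=> t; have [v ->] := quot_piW t.
  have Hv := divV v.
  pose Mp (v : V) := pi v \in @mul_ideal R (quotmod N) full_sub P.
  have M_sub : submodule_prop Mp.
    split=> [|a v1 v2 H1 H2]; first by rewrite /Mp linear0 rpred0.
    by rewrite /Mp linearP; apply: submod_comb.
  suff /mksubP : v \in mksub M_sub by [].
  apply: mul_ideal_least Hv => v1 c _ Pc; apply/mksubP.
  by rewrite /Mp linear_ract; apply: mem_mul_ideal Pc; apply: in_full.
- apply/Sz/Sr; apply: WN; last exact/submod_ract/cyc_sub_self.
  by apply/quot_pi0; rewrite quot_pi_ract.
pose e : {linear V -> quotmod N} := \pi_(quotmod N) \+ (del \o \pi_(quotmod W)).
have eE v : e v = pi v + del (\pi_(quotmod W) v) by [].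
have e_inj v : e v = 0 -> v = 0.
  move=> ev; apply: contrapT => /eqP v_neq0.
  have [n Kv] := pV v; have [r' [/eqP t0 Kt]] := killed_socle Kv v_neq0.
  apply: t0; have : e (v <* r') = 0 by rewrite linear_ract ev ract0r.
  move: (v <* r') Kt => t Kt et.
  have /sum_subP[_ /cyc_subP[a ->] Wt] := NW t Kt.
  have /quot_pi_eq piW : t - a *: y \in W by [].
  have Nt : t + z <* a \in N.
    apply/quot_pi0; rewrite quotmod_piD quot_pi_ract -et eE piW.
    by rewrite scale_ract quot_pi_ract linear_ract delE.
  have za0 : pi z <* a = 0.
    apply: (simple_elt_meet Sz N2z); apply/mksubP; exists (- t); last first.
      rewrite -linear_ract; apply/quot_pi_eq.
      by rewrite opprK addrC.
    by apply/(killed_subP P 1)/submodN/killed_subP.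
  have ya0 : a *: y = 0 by apply/Sr/Sz.
  apply: WN; first by rewrite ya0 subr0 in Wt.
  have -> : t = (t + z <* a) - z <* a by rewrite addrK.
  by apply: submodB => //; apply/quot_pi0; rewrite quot_pi_ract.
case/negP: y0; apply/eqP.
apply: (@bV V idfun N e) => [p|v _|p|]; last exact: cyc_sub_self.
- exact: quot_piW.
- by exists v.
- by split=> [/= p_eq0|/e_inj //]; rewrite -[LHS]/(e p) p_eq0; apply: (linear0 e).
Qed.

End BassianPrimary.

(** Let [D = V P^k] have the least possible socle. Then the elements of [D] killed
    by [P^n] lie in all [V P^l], by induction on [n], so [D] is divisible and
    vanishes; thus [V] is killed by [P^k]. *)
Lemma primary_noetherian (M V : lmodType R^c) (j : {linear V -> M}) :
  injective j -> hereditarily_Bassian M -> primary_module P V -> noetherian V.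
Proof.
move=> j_inj hM pV.
have bV := hereditarily_Bassian_strongly j_inj hM.
pose D k := iter k (fun Y : submodClosed V => mul_ideal Y P) full_sub.
have [k0 Hk0] := dcc_on_socle bV (W := D) (fun k => @mul_ideal_sub _ _ (D k) P).
have Ddec k : {subset D k.+1 <= D k} by apply: mul_ideal_sub.
have Dle i k : (i <= k)%N -> {subset D k <= D i}.
  by move=> /subnK <-; elim: (k - i)%N => //= l IH x /Ddec/IH.
have Ddiv n k v : (k0 <= k)%N -> killed P n v -> v \in D k0 -> v \in D k.
  elim: n k v => [|n IH] k v kk; first by move=> /= -> _; rewrite rpred0.
  move=> Kv Dv.
  have vP c : c \in P -> v <* c \in mul_ideal (D k) P.
    by move=> Pc; apply: (IH k.+1); [apply: leqW | apply: Kv | apply: submod_ract].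
  have [y Dy Hy] := mul_ideal_cancel iota_inj hR nrR invP vP.
  rewrite -(subrK y v) rpredD //; apply: (Hk0 k) => //.
  by apply: submodB => //; apply: Dle Dy.
pose jD : {linear submod (D k0) -> V} := \val.
have jD_inj : injective jD by apply: val_inj.
have D0 v : v \in D k0 -> v = 0.
  move=> Dv.
  suff H : Submod Dv = 0 by rewrite -[v]/(submod_val (Submod Dv)) H.
  apply: divisible_primary_zero.
  - apply: (@hereditarily_Bassian_strongly _ M _ (j \o jD)) => //.
    exact: inj_comp.
  - move=> w; have [n Hn] := pV (jD w); exists n; exact: killed_inj Hn.
  - move=> w; pose Tp (v : V) := exists2 w' : submod (D k0),
      w' \in @mul_ideal R (submod (D k0)) full_sub P & jD w' = v.
    have T_sub : submodule_prop Tp.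
      split=> [|a _ _ [w1 H1 <-] [w2 H2 <-]].
        by exists 0; rewrite ?rpred0 ?linear0.
      by exists (a *: w1 + w2); rewrite ?linearP //; apply: submod_comb.
    suff /mksubP[w' Hw' /jD_inj <-] : jD w \in mksub T_sub by [].
    have [n Hn] := pV (jD w).
    have : jD w \in D k0.+1 by apply: (Ddiv n) Hn (valP w).
    apply: mul_ideal_least => y c Dy Pc; apply/mksubP.
    exists (Submod Dy <* c); last by rewrite linear_ract.
    by apply: mem_mul_ideal Pc; apply: in_full.
have VK k i v : v \in D i -> (k0 <= i + k)%N -> killed P k v.
  elim: k i v => [|k IH] i v Dv ik; first by apply: D0; apply: Dle Dv; rewrite addn0 in ik.
  move=> p Pp; apply: (IH i.+1); last by rewrite addSnnS.
  exact: mem_mul_ideal.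
apply/noetherian_acc => N HN; have [n Hn] := acc_on_killed bV k0 HN.
by exists n => m nm v _; apply: Hn => //; apply: (VK k0 0%N); rewrite ?in_full.
Qed.

End Primary.

(** * Characterization of hereditarily Bassian modules *)

Section PrimaryComponents.
Context {R : nzRingType} {V : lmodType R^c} (P : ideal R).
Implicit Types x : V.

Lemma killed_mul_pow n m x (a : R) :
  killed P (n + m) x -> ideal_pow P n a -> killed P m (x <* a).
Proof.
elim: n m x a => [|n IH] m x a; first by move=> Hx _; apply: killed_ract.
rewrite addSnnS => Hx [k [y [z [Py Pz ->]]]]; apply/killed_subP.
rewrite ract_sumr; apply: rpred_sum => i _; apply/killed_subP.
by rewrite -ractA; apply: (IH m.+1 x (y i) Hx (Py i)); apply: Pz.
Qed.

Lemma ideal_pow_mull n (p q : R) :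
  p \in P -> ideal_pow P n q -> ideal_pow P n.+1 (p * q).
Proof.
move=> Pp; elim: n q => [|n IH] q.
  move=> _; exists 1%N, (fun=> 1), (fun=> p * q).
  by split=> // [_|]; [exact: (idealMr q Pp) | rewrite big_ord1 mul1r].
move=> [k [y [z [Py Pz ->]]]]; exists k, (fun i => p * y i), z.
split=> // [i|]; first exact: (IH _ (Py i)).
by rewrite mulr_sumr; apply: eq_bigr => i _; rewrite mulrA.
Qed.

Lemma killed_pow n x :
  killed P n x <-> forall p, ideal_pow P n p -> x <* p = 0.
Proof.
split=> [Hx p Pp|]; first by apply: (@killed_mul_pow n 0 x p) => //; rewrite addn0.
elim: n x => [|n IH] x Hx; first by rewrite /= -[x]ract1; apply: Hx.
by move=> p Pp; apply: IH => q Pq; rewrite ractA; apply/Hx/ideal_pow_mull.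
Qed.

Lemma primaryP x : reflect (exists n, killed P n x) (x \in primary P V).
Proof.
apply: (iffP (asboolP _)) => [[n _ Hn]|[n /killedS/killed_pow Hn]].
  by exists n; apply/killed_pow.
by exists n.+1.
Qed.

End PrimaryComponents.

Section Characterization.
Context {R : nzRingType} {Q : unitRingType} (iota : {rmorphism R -> Q}).
Hypothesis iota_inj : injective iota.
Hypothesis hR : left_hereditary R^c.
Hypothesis nlR : left_noetherian R.
Hypothesis nrR : left_noetherian R^c.
Hypothesis prR : prime_ring R.

Let nsR := hereditary_nonsingular hR nrR.

(** Take [a] with maximal annihilator among the nonzero elements: since the
    annihilator of [v a] contains that of [a], they agree if [v a <> 0]. By primeness every nonzero right ideal
    contains such a [v a], which makes [a R] embed in it. *)
Lemma maximal_annihilator : exists2 a : R, a != 0 &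
  forall v, v * a != 0 -> forall s, v * a * s = 0 -> a * s = 0.
Proof.
have An_sub (a : R) : submodule_prop (fun s : (R^c)^o => a * (s : R) = 0).
  split=> [|c s t Hs Ht]; first by rewrite mulr0.
  by rewrite mulrDr Ht addr0 mulrA Hs mul0r.
pose F (N : right_ideal R) := exists2 a, a != 0 & N = mksub (An_sub a).
have [|//|_ [[a a0 ->] amax]] := acc_max (F := F) (N0 := mksub (An_sub 1))
    (iffLR noetherian_acc nrR).
  by exists 1; rewrite ?oner_neq0.
exists a => // v va s vas; apply/(mksubP (An_sub a)).
apply: (amax (mksub (An_sub (v * a)))); last exact/mksubP.
  by exists (v * a).
by move=> t /mksubP Ht; apply/mksubP; rewrite -mulrA Ht mulr0.
Qed.

(** Otherwise [M] contains an infinite direct sum of copies of [a R], for [a] as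
    in the previous lemma: a nonsingular element of [M / G] generates a module
    containing a copy of a nonzero right ideal, hence of [a R], which lifts to [M]
    and meets [G] trivially. *)
Lemma strongly_Bassian_cosingular (M : lmodType R^c) : strongly_Bassian M ->
  exists G : submodClosed M, finitely_generated (submod G) /\ singular (quotmod G).
Proof.
move=> bM; have [a a0 amax] := maximal_annihilator.
have [|l [_ lP]] := @strongly_Bassian_greedy R^c M
    (fun y => forall s : R, y <* s = 0 <-> a * s = 0) (fun s => a * (s : R) = 0) bM.
  move=> y Hy; split; last exact: Hy.
  apply/eqP => y0; case/negP: a0; rewrite -[a]mulr1; apply/eqP/Hy.
  by rewrite y0 ract0r.
exists (gen_sub l); split; first by apply/finitely_generated_submod; exists l.
apply/singular_quotP => v x x0; apply: contrapT => Hno.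
have {}Hno (r : R) : v <* ((x : R) * r) \in gen_sub l -> (x : R) * r = 0.
  by move=> Hr; apply: contrapT => /eqP xr; apply: Hno; exists r.
have [t xta] := prime_elt prR x0 a0.
have [s|r [/eqP yr]] := lP (v <* ((x : R) * t * a)).
  rewrite ractA; split=> [vs|as0]; last by rewrite -mulrA as0 mulr0 ractr0.
  apply: (amax _ xta); rewrite -!mulrA; apply: Hno.
  by rewrite !mulrA vs rpred0.
rewrite scale_ract ractA -!mulrA => /Hno xr; apply: yr.
by rewrite scale_ract ractA -!mulrA xr ractr0.
Qed.

(** A maximal nonsingular submodule [G'] of [G] works: if [G / G'] were not
    singular, then [G'] could be enlarged by a copy of a right ideal. *)
Lemma nonsingular_cosingular (M : lmodType R^c) (G : submodClosed M) :
  finitely_generated (submod G) -> singular (quotmod G) ->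
  exists G' : submodClosed M, [/\ finitely_generated (submod G'),
    nonsingular (submod G') & singular (quotmod G')].
Proof.
move=> fG /singular_quotP sG.
have accG : acc_on (fun v : M => v \in G).
  have nG := finitely_generated_noetherian nrR fG.
  move=> N HN; have [n Hn] := acc_on_preim (\val : {linear submod G -> M})
    (j := (idfun : {linear M -> M})) (fun _ _ => id) nG HN.
  by exists n => m nm v Gv; apply: Hn => //; exists (Submod Gv).
pose F (L : submodClosed M) := {subset L <= G} /\
  forall v, v \in L -> v \in Sing M -> v = 0.
have [||G' [[G'G nsG'] G'max]] := acc_max (F := F) (N0 := zero_sub) accG.
- by split=> v /mksubP -> //; rewrite rpred0.
- by move=> L [LG _] v; apply: LG.
exists G'; split.
- by apply/finitely_generated_submod/(acc_on_fg accG).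
- move=> v /(Sing_inj (j := (\val : {linear submod G' -> M})) _ val_inj) Sv.
  by apply: val_inj; apply: nsG' Sv; apply: valP.
apply/singular_quotP => v; apply: (ess_trans nsR (sG v)) => x Gx.
set g := x *: v in Gx; suff H : ess (fun s : R^c => s *: g \in G').
  by apply: (ess_sub H) => s; rewrite scalerA.
move=> k k0; apply: contrapT => Hno.
have {}Hno (r : R) : g <* ((k : R) * r) \in G' -> (k : R) * r = 0.
  by move=> Hr; apply: contrapT => /eqP kr; apply: Hno; exists r.
have gk : g <* (k : R) \in G'.
  apply: (G'max (sum_sub G' (cyc_sub (g <* (k : R))))); last 1 first.
  - exact/sum_subr/cyc_sub_self.
  - split=> [w /sum_subP[g' Gg' /cyc_subP[c wE]]|w /sum_subP[g' Gg' /cyc_subP[c wE]]].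
      rewrite -(subrK g' w) wE; apply: rpredD; last exact: G'G.
      by rewrite scale_ract; do 2!apply: submod_ract.
    move=> /SingP Sw; have {}wE : w = g' + g <* ((k : R) * (c : R)).
      by rewrite -ractA -scale_ract -wE addrC subrK.
    have kc : (k : R) * (c : R) = 0.
      apply: (nonsing_eq0 nsR Sw) => r; rewrite scale_ract wE ractDl ractA -mulrA.
      move=> H; suff: (k : R) * ((c : R) * (r : R)) = 0 by rewrite mulrA.
      apply: Hno; move/eqP: H; rewrite addrC addr_eq0 => /eqP ->.
      exact/submodN/submod_ract.
    rewrite wE kc ractr0 addr0; apply: nsG' => //.
    by apply/SingP; rewrite wE kc ractr0 addr0 in Sw.
  - by move=> w Gw; apply: sum_subl.
by case/negP: k0; rewrite -[k](mulr1 (k : R)); apply/eqP/Hno; rewrite mulr1.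
Qed.

Hypothesis npR : ~ left_primitive R^c.
Hypothesis dedR : forall I : ideal R, ~ ideal_zero I -> invertible_ideal iota I.

Lemma elt_ann_ideal_prop (V : lmodType R^c) (x : V) :
  ideal_prop (fun z => forall a, x <* (a * z) = 0).
Proof.
split=> [a|y z Hy Hz a|b z Hz a|b z Hz a]; first by rewrite mulr0 ractr0.
- by rewrite mulrDr ractDr Hy Hz addr0.
- by rewrite mulrA Hz.
- by rewrite mulrA -ractA Hz ract0r.
Qed.

(** The annihilator of the cyclic module [x R]; that of [x] itself is only a right
    ideal. *)
Definition elt_ann (V : lmodType R^c) (x : V) : ideal R :=
  mkideal (elt_ann_ideal_prop x).

Lemma elt_ann_nonzero (V : lmodType R^c) (x : V) :
  x \in Sing V -> ~ ideal_zero (elt_ann x).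
Proof.
move=> /SingP Sx.
have An_sub : submodule_prop (fun s : (R^c)^o => x <* (s : R) = 0).
  split=> [|c s t Hs Ht]; first by rewrite ractr0.
  by rewrite ractDr Ht addr0 -[x <* (c *: s)]ractA Hs ract0r.
have [|r r0 Hr] := essential_bounded hR nlR nrR prR npR (E := mksub An_sub).
  by apply: (ess_sub Sx) => s Hs; apply/(mksubP An_sub); exact: Hs.
by apply: (nonzero_ideal _ r0); apply/mkidealP => a; apply/(mksubP An_sub).
Qed.

Lemma elt_ann_proper (V : lmodType R^c) (x : V) : x != 0 -> 1 \notin elt_ann x.
Proof.
by move=> x0; apply: contraNN x0 => /mkidealP/(_ 1); rewrite mulr1 ract1 => ->.
Qed.

(** Let [P] contain the annihilator [I] of [x R]. Since [I P^-1] is larger than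
    [I], it does not kill [x R], whereas [I P^-1 P] does. *)
Lemma singular_socle (V : lmodType R^c) (x : V) : x \in Sing V -> x != 0 ->
  exists P r, [/\ maximal_invertible iota P, x <* r != 0 & killed P 1 (x <* r)].
Proof.
move=> Sx x0; have I0 := elt_ann_nonzero Sx.
have [P mP IP] := maximal_invertible_exists dedR nrR I0 (elt_ann_proper x0).
have [[P1 invP] _] := mP.
have [r /mkidealP Pr Ir] := residual_ideal_proper iota_inj (dedR I0) invP P1 IP.
have [a xar] : exists a, x <* (a * r) != 0.
  apply: contrapT => Hno; case/negP: Ir; apply/mkidealP => a.
  by apply: contrapT => /eqP H; apply: Hno; exists a.
exists P, (a * r); split=> // p Pp; rewrite /= ractA -mulrA.
by have /mkidealP := Pr p Pp; apply.
Qed.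

(** The annihilator of [y R] contains a product [J P^m] with [J] comaximal to [P];
    [y j], with [j] in [J] and [1 - j] in [P], stands in for the [P]-component
    of [y]. *)
Lemma singular_component (V : lmodType R^c) (y : V) P :
  y \in Sing V -> maximal_invertible iota P ->
  exists m j, 1 - j \in P /\ killed P m (y <* j).
Proof.
move=> Sy mP.
have [m [j [Pj jm]]] := ideal_factor iota_inj dedR nrR (elt_ann_nonzero Sy) mP.
exists m, j; split=> //; elim: m j {Pj} jm => [|m IH] j Hj.
  have /mkidealP/(_ 1) : j \in elt_ann y := Hj.
  by rewrite mul1r.
by move=> p Pp; rewrite ractA; apply: IH; apply: Hj.
Qed.

Section Chain.
Context {V : lmodType R^c} (N : submodClosed V) (f : {linear V -> quotmod N}).
Hypothesis f_inj : injective f.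

Lemma pullback_submodule (L : submodClosed V) :
  submodule_prop (fun v => exists2 w, w \in L & f w = \pi_(quotmod N) v).
Proof.
split=> [|a v w [v' Lv Hv] [w' Lw Hw]].
  by exists 0; rewrite ?rpred0 // !linear0.
by exists (a *: v' + w'); [exact: submod_comb | rewrite !linearP Hv Hw].
Qed.

(** All factors of the chain [0, N, pi^-1 (f N), ...] are isomorphic to [N],
    through [f^-1 pi]. *)
Fixpoint chain (k : nat) : submodClosed V :=
  if k is i.+1 then mksub (pullback_submodule (chain i)) else zero_sub.

Lemma chainS k : {subset chain k <= chain k.+1}.
Proof.
elim: k => [|k IH] v /mksubP.
  by move=> ->; apply/mksubP; exists 0; rewrite ?rpred0 // !linear0.
by case=> w /IH Cw fw; apply/mksubP; exists w.
Qed.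

Lemma chain1 v : (v \in chain 1) = (v \in N).
Proof.
apply/idP/idP => [/mksubP[w /mksubP -> ]|Nv].
  by rewrite linear0 => /esym/quot_pi0.
by apply/mksubP; exists 0; rewrite ?rpred0 // linear0; apply/esym/quot_pi0.
Qed.

(** The relation between [y] and its image [x] under [k] of these isomorphisms. *)
Fixpoint linked (k : nat) (y x : V) : Prop :=
  if k is i.+1 then exists2 z, linked i z x & f z = \pi_(quotmod N) y else y = x.

Lemma linked_ract k y x r : linked k y x -> linked k (y <* r) (x <* r).
Proof.
elim: k y => [|k IH] y /=; first by move=> ->.
by case=> z /IH Hz fz; exists (z <* r); rewrite // linear_ract fz quot_pi_ract.
Qed.

Lemma linked_exists k x : exists y, linked k y x.
Proof.
elim: k => [|k [z Hz]]; first by exists x.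
by have [y Hy] := quot_piW (f z); exists y; exists z.
Qed.

Lemma linked_chain k i y x : linked k y x -> (y \in chain (k + i)) = (x \in chain i).
Proof.
elim: k y => [|k IH] y; first by move=> /= ->.
case=> z /IH <- fz; rewrite addSn; apply/idP/idP => [/mksubP[w Cw]|Cz].
  by rewrite -fz => /f_inj <-.
by apply/mksubP; exists z.
Qed.

End Chain.

(** The chain attached to a monomorphism [V -> V / N] is stationary on [G], so its
    factors, which are copies of [N], are singular. It is also stationary on each
    primary component, so [N] has no nonzero element killed by a maximal
    invertible ideal, and a singular module without such elements is zero. *)
Lemma Bassian_of_acc (M V : lmodType R^c) (j : {linear V -> M}) (G : submodClosed M) :
  injective j -> noetherian (submod G) -> singular (quotmod G) ->
  (forall P, maximal_invertible iota P ->
     noetherian (submod (primary P (submod (Sing M))))) ->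
  Bassian V.
Proof.
move=> j_inj nG /singular_quotP sG nP N [f f_inj] x Nx.
pose C := chain f.
have CS k : {subset C k <= C k.+1} by apply: chainS.
have NS z : z \in N -> z \in Sing V.
  move=> Nz; apply/SingP.
  have [k Hk] := acc_on_preim (\val : {linear submod G -> M}) j_inj nG CS.
  have [y yz] := linked_exists f k z.
  have Cy : y \in C k.+1 by rewrite -addn1 (linked_chain f_inj 1 yz) chain1.
  apply: (ess_sub (sG (j y))) => r; rewrite !scale_ract -linear_ract => Gyr.
  have : z <* (r : R) \in C 0%N.
    rewrite -(linked_chain f_inj 0 (linked_ract r yz)) addn0.
    apply: (Hk k.+1) => //; last exact: submod_ract.
    by exists (Submod Gyr).
  by move=> /mksubP.
have CSing k : {subset C k <= Sing V}.
  elim: k => [|k IH] v /mksubP; first by move=> ->; rewrite rpred0.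
  case=> w /IH/SingP Sw fw; apply: (Sing_closed nsR); apply: (ess_sub Sw) => r rw.
  apply/NS/quot_pi0; rewrite scale_ract quot_pi_ract -fw -linear_ract.
  by rewrite -scale_ract rw linear0.
apply: contrapT => /eqP x0.
have [P [r [mP xr0 Pxr]]] := singular_socle (NS x Nx) x0.
pose val2 : {linear submod (primary P (submod (Sing M))) -> M} :=
  (\val : {linear submod (Sing M) -> M}) \o \val.
have [k Hk] := acc_on_preim val2 j_inj (nP P mP) CS.
have [y yx] := linked_exists f k (x <* r).
have Cy : y \in C k.+1.
  by rewrite -addn1 (linked_chain f_inj 1 yx) chain1 submod_ract.
have [m [i [Pi Kyi]]] := singular_component (CSing _ _ Cy) mP.
have Syi : j (y <* i) \in Sing M.
  by apply/(Sing_inj _ j_inj)/submod_ract/(CSing k.+1).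
have Pyi : Submod Syi \in primary P (submod (Sing M)).
  apply/primaryP; exists m.
  apply: (killed_inj (f := (\val : {linear submod (Sing M) -> M})) val_inj).
  exact: (killed_linear j Kyi).
have : x <* r <* i \in C 0%N.
  rewrite -(linked_chain f_inj 0 (linked_ract i yx)) addn0.
  apply: (Hk k.+1) => //; last exact: submod_ract.
  by exists (Submod Pyi).
move=> /mksubP xri; case/negP: xr0; apply/eqP.
by rewrite -[_ <* r]ract1 -(subrK i 1) ractDr xri (Pxr _ Pi) add0r.
Qed.

End Characterization.

Theorem theorem2p9 (R : nzRingType) (Q : unitRingType)
    (iota : {rmorphism R -> Q})
    (hR : Dedekind_prime iota) (hnp : nonprimitive R)
    (M : lmodType R^c) :
  (hereditarily_Bassian M <->
    (forall P : ideal R, maximal_invertible iota P ->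
       noetherian (submod (primary P (submod (Sing M))))) /\
    (exists G : submodClosed M,
       [/\ finitely_generated (submod G), nonsingular (submod G)
         & singular (quotmod G)]))
  /\
  (hereditarily_Bassian M <->
    (forall P : ideal R, maximal_invertible iota P ->
       finitely_generated (submod (primary P (submod (Sing M))))) /\
    (exists G : submodClosed M,
       finitely_generated (submod G) /\ singular (quotmod G))).
Proof.
have [[[_ hrR] [nlR nrR] prR] [iota_inj _ _ _] dedR] := hR.
have [_ npR] := hnp.
have nec : hereditarily_Bassian M ->
    (forall P : ideal R, maximal_invertible iota P ->
       noetherian (submod (primary P (submod (Sing M))))) /\
    (exists G : submodClosed M,
       [/\ finitely_generated (submod G), nonsingular (submod G)
         & singular (quotmod G)]).
  move=> hM; split=> [P mP|].
    have [u uP] := simple_generator_exists iota_inj hrR nlR nrR mP.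
    pose val2 : {linear submod (primary P (submod (Sing M))) -> M} :=
      (\val : {linear submod (Sing M) -> M}) \o \val.
    apply: (primary_noetherian iota_inj hrR nrR dedR mP uP (j := val2)) => //.
      by apply: inj_comp; apply: val_inj.
    move=> x; have /primaryP[n Hn] := valP x; exists n.
    exact: (killed_inj (f := (\val : {linear submod (primary P (submod (Sing M))) -> _})) val_inj).
  have bM : strongly_Bassian M.
    exact: (@hereditarily_Bassian_strongly _ M M idfun).
  have [G [fG sG]] := strongly_Bassian_cosingular nrR prR bM.
  exact: nonsingular_cosingular sG.
have suf : (forall P : ideal R, maximal_invertible iota P ->
       finitely_generated (submod (primary P (submod (Sing M))))) /\
    (exists G : submodClosed M,
       finitely_generated (submod G) /\ singular (quotmod G)) ->
    hereditarily_Bassian M.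
  move=> [fP [G [fG sG]]] S.
  apply: (Bassian_of_acc iota_inj hrR nlR nrR prR npR dedR
    (j := (\val : {linear submod S -> M})) (G := G)) => //.
  - exact: val_inj.
  - exact: finitely_generated_noetherian.
  - by move=> P mP; apply/finitely_generated_noetherian/fP.
have weaken : (forall P : ideal R, maximal_invertible iota P ->
       noetherian (submod (primary P (submod (Sing M))))) /\
    (exists G : submodClosed M,
       [/\ finitely_generated (submod G), nonsingular (submod G)
         & singular (quotmod G)]) ->
    (forall P : ideal R, maximal_invertible iota P ->
       finitely_generated (submod (primary P (submod (Sing M))))) /\
    (exists G : submodClosed M,
       finitely_generated (submod G) /\ singular (quotmod G)).
  move=> [nP [G [fG _ sG]]]; split; last by exists G.
  by move=> P mP; apply/noetherian_finitely_generated/nP.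
by split; split=> H; [exact: nec | exact/suf/weaken | exact/weaken/nec | exact: suf].
Qed.
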